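(* Let $M,N,K\ge1$ be integers, let $\mathbf H_1,\dots,\mathbf H_K\in\mathbb C^{N\times M}$ be nonzero, and let $W,\sigma^2,\eta,P_{\rm dyn},P_{\rm sta}>0$. Consider the energy efficient iterative waterfilling scheme (defined in the context), started from $\mathbf Q_1^{(0)}=\dots=\mathbf Q_K^{(0)}=\mathbf 0$, and let $\mathbf Q^{(k)}=(\mathbf Q_1^{(k)},\dots,\mathbf Q_K^{(k)})$ be the tuple obtained after $k$ full sweeps. Then the scheme converges: the sequence of energy efficiency values $g(\mathbf Q^{(k)})$ converges to a limit as $k\to\infty$, and the sequence of tuples $\mathbf Q^{(k)}$ also converges to a limit.
   Context: $|\cdot|$ denotes the determinant, $\log$ is the base-2 logarithm, $^H$ is the conjugate transpose, $\succeq 0$ means Hermitian positive semidefinite. For Hermitian positive semidefinite $\mathbf Q_1,\dots,\mathbf Q_K\in\mathbb C^{N\times N}$, $$g(\mathbf Q_1,\dots,\mathbf Q_K)=\frac{W\log\left|\mathbf I+\frac1{\sigma^2}\sum_{i=1}^K\mathbf H_i^H\mathbf Q_i\mathbf H_i\right|}{\frac1\eta\sum_{i=1}^K{\rm Tr}(\mathbf Q_i)+MP_{\rm dyn}+P_{\rm sta}} .$$ The energy efficient iterative waterfilling scheme is cyclic block-coordinate ascent on $g$: given $\mathbf Q^{(k)}$, for $i=1,\dots,K$ in order, $\mathbf Q_i^{(k+1)}$ is the (unique) maximizer over $\mathbf Q_i\succeq 0$ of $$g\left(\mathbf Q_1^{(k+1)},\dots,\mathbf Q_{i-1}^{(k+1)},\mathbf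 Q_i,\mathbf Q_{i+1}^{(k)},\dots,\mathbf Q_K^{(k)}\right).$$ *)

(* Defs.v *)
From mathcomp Require Import all_boot all_order all_algebra.
From mathcomp Require Import all_classical all_reals all_analysis.
From mathcomp Require Export complex.

Set Implicit Arguments.
Unset Strict Implicit.
Unset Printing Implicit Defensive.

Import Order.TTheory GRing.Theory Num.Theory.
Import numFieldNormedType.Exports.

Local Open Scope ring_scope.
Local Open Scope complex_scope.
Local Open Scope sesquilinear_scope.

Definition log2 (R : realType) (x : R) : R := ln x / ln 2.

(* The order on R[i] is partial: 0 <= z says that z is real and nonnegative. *)
Definition psdmx (R : realType) (n : nat) (A : 'M[R[i]]_n) : Prop :=
  A \is hermsymmx /\ forall x : 'cV[R[i]]_n, 0 <= (x^t* *m A *m x) 0 0.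

(* Re only moves the determinant and the traces from R[i] to R: when every Q i
   is positive semidefinite they are real, and the determinant is at least 1. *)
Definition energy_efficiency (R : realType) (M N K : nat)
    (H : 'I_K -> 'M[R[i]]_(N, M)) (W sigma2 eta Pdyn Psta : R)
    (Q : 'I_K -> 'M[R[i]]_N) : R :=
  W * log2 (complex.Re (\det (1%:M +
        (sigma2^-1)%:C *: \sum_(i < K) ((H i)^t* *m Q i *m H i))))
  / (eta^-1 * (\sum_(i < K) complex.Re (\tr (Q i))) + M%:R * Pdyn + Psta).

(* The point at which block i is updated during a sweep: blocks before i are
   already new, blocks after i are still old, and block i is the variable X. *)
Definition sweep_point (T : Type) (K : nat) (new old : 'I_K -> T) (i : 'I_K)
    (X : T) : 'I_K -> T :=
  fun j => if (j < i)%N then new j else if j == i then X else old j.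

(* Q k is the tuple after k full sweeps of cyclic block-coordinate ascent on g
   over positive semidefinite blocks, started from 0. *)
Definition iterative_waterfilling (R : realType) (N K : nat)
    (g : ('I_K -> 'M[R[i]]_N) -> R) (Q : nat -> 'I_K -> 'M[R[i]]_N) : Prop :=
  (forall i, Q 0%N i = 0) /\
  forall k i,
    psdmx (Q k.+1 i) /\
    forall X : 'M[R[i]]_N, psdmx X ->
      g (sweep_point (Q k.+1) (Q k) i X) <=
      g (sweep_point (Q k.+1) (Q k) i (Q k.+1 i)).

(* Main.v *)
(* The surrogate [a * ld (cov Q) - lambda * pow Q] of Dinkelbach is concave, and
   even strongly concave in the received covariance [cov Q].  A block update
   that maximizes [ee] with value [lambda] maximizes the surrogate of [lambda]
   in that block.  Hence, over a sweep, the sum of the squared changes of the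
   received covariances is at most a multiple of the gain of [ee]; and the gap
   to the maximum [lambda*] is at most the square root of the gain times the
   distance from the iterate to any maximizer.  This alone gives the rate O(1/k),
   which does not make the changes summable: the maximizers need not be unique.

   The missing factor is a Hoelder error bound: with [Q i = B i *m (B i)^t* ],
   the maximizers are the zeros of a polynomial in the entries of the [B i],
   which is dominated by the gap, and the Lojasiewicz inequality bounds the
   distance to its zeros.  Together these bounds make the changes summable, so
   that the received covariances converge; each [Q i] is recovered from them
   by its stationarity equation.

   The Lojasiewicz inequality itself comes from quantifier elimination: the
   pairs (value of the polynomial, lower bound of the distance) form a plane
   semialgebraic set, hence a set that is described by the signs of finitely
   many polynomials in two variables. *)

From HB Require Import structures.
Require Import Defs.
From mathcomp Require Import all_boot all_order all_algebra.
From mathcomp Require Import all_classical all_reals all_analysis.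
From mathcomp Require Import complex.
From mathcomp Require Import ring lra.
From mathcomp Require polyrcf ordered_qelim qe_rcf.

Set Implicit Arguments.
Unset Strict Implicit.
Unset Printing Implicit Defensive.

Import Order.TTheory GRing.Theory Num.Theory.
Import numFieldNormedType.Exports.
Module QE := ordered_qelim.ord.

Local Open Scope ring_scope.
Local Open Scope complex_scope.
Local Open Scope sesquilinear_scope.

(** The value of [ee] involves a logarithm, so semialgebraic arguments do not apply to it directly.
    What is algebraic is the set of maximizers: by strong concavity they all share one received
    covariance and, since the maximal value is positive, one power. Equality with these two data
    cuts the maximizers out, and the gap controls the squared distance to these data. The factors
    [B i] remove the semidefinite constraint and make the total power the squared norm of the
    parameters, so that coercivity of [ee] becomes compactness of a ball. Coercivity, the error
    bound and the stationarity equation all ask for a positive value; the start has value zero, but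
    the first block update makes it positive because the channels are nonzero. The received
    covariance of each single user is controlled, and not only their sum, because a block update
    moves only one of them. It may still lose information on [Q i], which is why stationarity is
    called upon. Each block is optimal only at the intermediate tuple right after its update;
    passing from there to the end of the sweep costs a multiple of the square root of the gain. *)

Section Lojasiewicz.
Variable R : realType.

(** * Signs of polynomials in two variables and plane semialgebraic sets *)

Definition bihorner (p : {poly {poly R}}) (t s : R) : R := p.[t%:P].[s].

Lemma eval_bihorner (u : GRing.term R) : GRing.rterm u ->
  exists p, forall t s, GRing.eval [:: t; s] u = bihorner p t s.
Proof.
elim: u => //=.
- move=> [|[|n]] _.
  + by exists 'X => t s; rewrite /bihorner hornerX hornerC.
  + by exists ('X%:P) => t s; rewrite /bihorner hornerC hornerX.
  + by exists 0 => t s; rewrite /bihorner !horner0 /= nth_nil.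
- by move=> x _; exists (x%:P%:P) => t s; rewrite /bihorner !hornerC.
- by move=> n _; exists n%:R => t s; rewrite /bihorner !(hornerMn, hornerC).
- move=> u IHu v IHv /andP[/IHu [p hp] /IHv [q hq]].
  by exists (p + q) => t s; rewrite hp hq /bihorner !hornerD.
- move=> u IHu /IHu [p hp].
  by exists (- p) => t s; rewrite hp /bihorner !hornerN.
- move=> u IHu n /IHu [p hp].
  by exists (p *+ n) => t s; rewrite hp /bihorner !hornerMn.
- move=> u IHu v IHv /andP[/IHu [p hp] /IHv [q hq]].
  by exists (p * q) => t s; rewrite hp hq /bihorner !hornerM.
- move=> u IHu n /IHu [p hp].
  by exists (p ^+ n) => t s; rewrite hp /bihorner !horner_exp.
Qed.

(** Each atom compares the difference of two terms with zero, so its truth depends on the sign of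
    one polynomial. [t] stays fixed because the sets are explored along vertical lines only. *)
Lemma qf_eval_sgr (f : QE.formula R) : QE.qf_form f && QE.rformula f ->
  exists ps : seq {poly {poly R}}, forall t s s',
    (forall p, p \in ps -> Num.sg (bihorner p t s) = Num.sg (bihorner p t s')) ->
    QE.qf_eval [:: t; s] f = QE.qf_eval [:: t; s'] f.
Proof.
have cat (ps qs : seq {poly {poly R}}) t s s' :
    (forall p, p \in ps ++ qs ->
      Num.sg (bihorner p t s) = Num.sg (bihorner p t s')) ->
    (forall p, p \in ps ->
      Num.sg (bihorner p t s) = Num.sg (bihorner p t s')) /\
    (forall p, p \in qs ->
      Num.sg (bihorner p t s) = Num.sg (bihorner p t s')).
  by move=> h; split=> p hp; apply: h; rewrite mem_cat hp ?orbT.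
have atom u v : GRing.rterm u && GRing.rterm v ->
    exists p : {poly {poly R}}, forall t s,
      GRing.eval [:: t; s] u - GRing.eval [:: t; s] v = bihorner p t s.
  move=> /andP[/eval_bihorner [p hp] /eval_bihorner [q hq]].
  by exists (p - q) => t s; rewrite hp hq /bihorner !(hornerD, hornerN).
elim: f => //=.
- by move=> b _; exists [::].
- move=> u v /atom [p hp]; exists [:: p] => t s s' /(_ p (mem_head _ _)) h.
  by rewrite -subr_eq0 -[in RHS]subr_eq0 !hp -sgr_eq0 h sgr_eq0.
- move=> u v /atom [p hp]; exists [:: p] => t s s' /(_ p (mem_head _ _)) h.
  by rewrite -subr_lt0 -[in RHS]subr_lt0 !hp -sgr_lt0 h sgr_lt0.
- move=> u v /atom [p hp]; exists [:: p] => t s s' /(_ p (mem_head _ _)) h.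
  by rewrite -subr_le0 -[in RHS]subr_le0 !hp -sgr_le0 h sgr_le0.
- move=> f IHf g IHg /andP[/andP[qf qg] /andP[rf rg]].
  have [|ps hps] := IHf; first by rewrite qf rf.
  have [|qs hqs] := IHg; first by rewrite qg rg.
  exists (ps ++ qs) => t s s' /cat [h1 h2].
  by rewrite (hps t s s') // (hqs t s s').
- move=> f IHf g IHg /andP[/andP[qf qg] /andP[rf rg]].
  have [|ps hps] := IHf; first by rewrite qf rf.
  have [|qs hqs] := IHg; first by rewrite qg rg.
  exists (ps ++ qs) => t s s' /cat [h1 h2].
  by rewrite (hps t s s') // (hqs t s s').
- move=> f IHf g IHg /andP[/andP[qf qg] /andP[rf rg]].
  have [|ps hps] := IHf; first by rewrite qf rf.
  have [|qs hqs] := IHg; first by rewrite qg rg.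
  exists (ps ++ qs) => t s s' /cat [h1 h2].
  by rewrite (hps t s s') // (hqs t s s').
- move=> f IHf /IHf [ps hps]; exists ps => t s s' h.
  by rewrite (hps t s s').
Qed.

Lemma holds_sgr (f : QE.formula R) :
  exists ps : seq {poly {poly R}}, forall t s s',
    (forall p, p \in ps -> Num.sg (bihorner p t s) = Num.sg (bihorner p t s')) ->
    QE.holds [:: t; s] f -> QE.holds [:: t; s'] f.
Proof.
have [ps hps] := qf_eval_sgr (QE.quantifier_elim_wf
  (@qe_rcf.wf_QE_wproj R) (QE.to_rform_rformula f)).
exists ps => t s s' h /(qe_rcf.rcf_satP) hs.
by apply/qe_rcf.rcf_satP; rewrite /qe_rcf.rcf_sat /QE.proj_sat -(hps t s s').
Qed.

Lemma horner_bounded (p : {poly R}) :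
  exists2 C : R, 0 <= C & forall s, `|s| <= 1 -> `|p.[s]| <= C.
Proof.
elim/poly_ind: p => [|p c [C C0 hC]].
  by exists 0 => // s _; rewrite horner0 normr0.
exists (C + `|c|) => [|s hs]; first by rewrite addr_ge0.
rewrite !hornerE (le_trans (ler_normD _ _)) // lerD2r normrM.
by rewrite -[C]mulr1 ler_pM // hC.
Qed.

Lemma bihorner_bounded (p : {poly {poly R}}) :
  exists2 C : R, 0 <= C & forall t s, `|t| <= 1 -> `|s| <= 1 ->
    `|bihorner p t s| <= C.
Proof.
elim/poly_ind: p => [|p c [C C0 hC]].
  by exists 0 => // t s _ _; rewrite /bihorner !horner0 normr0.
have [D D0 hD] := horner_bounded c.
exists (C + D) => [|t s ht hs]; first by rewrite addr_ge0.
rewrite /bihorner !hornerE (le_trans (ler_normD _ _)) // lerD ?hD // normrM.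
by rewrite -[C]mulr1 ler_pM // hC.
Qed.

Lemma sgr_horner_itv (p : {poly R}) (a b : R) : a <= b ->
  (forall x, a <= x <= b -> p.[x] != 0) -> Num.sg p.[a] = Num.sg p.[b].
Proof.
move=> ab h; apply/eqP; apply: contraT => hs.
have ha := h a; rewrite lexx ab /= in ha.
have hb := h b; rewrite lexx ab /= in hb.
have hab : p.[a] * p.[b] <= 0.
  rewrite -sgr_le0 sgrM; move: (ha isT) (hb isT) hs.
  by case: sgrP => // _ _; case: sgrP => // _ _; rewrite ?mulr1 ?mul1r ?lerN10 ?eqxx.
have [x] := polyrcf.poly_ivt ab hab.
rewrite in_itv /= => hx /rootP px.
by have := h x hx; rewrite px eqxx.
Qed.

(** For [t > 0] a factor [t ^+ n] has constant sign, so the largest power of [t] is removed from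
    every nonzero polynomial, and [q] is the product of the quotients. Its restriction [q.[0]] to
    the axis [t = 0] is then nonzero, as the bound on the roots requires. *)
Lemma bihorner_sgr_itv (ps : seq {poly {poly R}}) :
  exists2 q : {poly {poly R}}, q.[0] != 0 &
    forall t a b, 0 < t -> a <= b ->
      (forall s, a <= s <= b -> bihorner q t s != 0) ->
      forall p, p \in ps -> Num.sg (bihorner p t a) = Num.sg (bihorner p t b).
Proof.
elim: ps => [|p ps [q q0 hq]].
  by exists 1 => //; rewrite hornerC oner_eq0.
have [-> | pN0] := eqVneq p 0.
  exists q => // t a b t0 ab h r; rewrite inE => /predU1P[-> | /hq]; last exact.
  by rewrite /bihorner !horner0.
have [n [r]] := multiplicity_XsubC p 0; rewrite pN0 /= => r0 pE.
exists (r * q) => [|t a b t0 ab h p']; first by rewrite hornerM mulf_neq0.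
have {}h x : a <= x <= b -> bihorner r t x != 0 /\ bihorner q t x != 0.
  by move=> /h; rewrite /bihorner !hornerM mulf_eq0 negb_or => /andP[].
rewrite inE => /predU1P[-> | hp']; last first.
  by apply: (hq t a b t0 ab _ p' hp') => s /h[].
apply: sgr_horner_itv => // s /h[hr _].
rewrite pE !(hornerM, horner_exp, hornerXsubC) subr0 mulf_neq0 //.
by rewrite hornerC expf_neq0 // gt_eqF.
Qed.

(** On the axis, [q] is [s ^+ m * r.[s]] with [r.[0] != 0], and off the axis it differs from this by
    [t] times a bounded polynomial. At a root the two terms balance, and [r] stays away from zero
    for small [s]. *)
Lemma bihorner_root_bound (q : {poly {poly R}}) : q.[0] != 0 ->
  exists m : nat, exists C e : R, [/\ 0 <= C, 0 < e &
    forall t s, 0 < t <= 1 -> 0 <= s <= e -> bihorner q t s = 0 ->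
      s ^+ m <= C * t].
Proof.
move=> q0; have [m [r]] := multiplicity_XsubC q.[0] 0.
rewrite q0 /= => r0 q0E.
have /factor_theorem[q1 q1E] : root (q - q.[0]%:P) 0.
  by rewrite /root !hornerE subrr.
have /factor_theorem[r1 r1E] : root (r - r.[0]%:P) 0.
  by rewrite /root !hornerE subrr.
have [C C0 hC] := bihorner_bounded q1.
have [D D0 hD] := horner_bounded r1.
have rN0 : 0 < `|r.[0]| by rewrite normr_gt0.
pose c := `|r.[0]| / 2; have c0 : 0 < c by rewrite divr_gt0.
(* [r] moves by at most [(D + 1) * s] from [r.[0]], hence by at most half of [r.[0]] in modulus; the
   bounds [hC] and [hD] hold up to 1. *)
pose e := Num.min 1 (c / (D + 1)).
have D1 : 0 < D + 1 by rewrite ltr_pwDr.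
have e0 : 0 < e by rewrite lt_min ltr01 divr_gt0.
exists m, (C / c), e; split=> //; first by rewrite divr_ge0 // ltW.
move=> t s /andP[t0 t1] /andP[s0 se] qts.
have s1 : s <= 1 by rewrite (le_trans se) // ge_min lexx.
have hr : c <= `|r.[s]|.
  have rsE : r.[s] = r.[0] + r1.[s] * s.
    have := congr1 (fun p => p.[s]) r1E; rewrite !hornerE subr0 => /eqP.
    by rewrite subr_eq addrC => /eqP.
  have : `|r1.[s] * s| <= c.
    have hs : `|s| <= 1 by rewrite ger0_norm.
    have rD : `|r1.[s]| <= D + 1 by rewrite (le_trans (hD s hs)) // lerDl.
    rewrite normrM (ger0_norm s0) (le_trans (ler_wpM2r s0 rD)) //.
    by rewrite mulrC -ler_pdivlMr // (le_trans se) // ge_min lexx orbT.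
  have := lerB_normD r.[0] (r1.[s] * s); rewrite -rsE.
  have -> : `|r.[0]| = c + c by rewrite -splitr.
  by move=> h1 h2; rewrite (le_trans _ h1) // -addrA lerDl subr_ge0.
have : r.[s] * s ^+ m = - (bihorner q1 t s * t).
  have := congr1 (fun p => p.[t%:P].[s]) q1E.
  rewrite hornerM hornerXsubC hornerM !(hornerD, hornerN, hornerC) subr0.
  rewrite -/(bihorner q t s) -/(bihorner q1 t s) qts => <-.
  by rewrite q0E hornerM horner_exp hornerXsubC subr0 sub0r opprK.
move/(congr1 Num.norm); rewrite normrM normrN normrM.
rewrite (ger0_norm (exprn_ge0 _ s0)) (gtr0_norm t0) => hE.
rewrite mulrAC ler_pdivlMr // mulrC.
rewrite (@le_trans _ _ (`|r.[s]| * s ^+ m)) //.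
  by rewrite ler_wpM2r ?exprn_ge0.
by rewrite hE; apply: ler_wpM2r; [exact: ltW | apply: hC; rewrite ger0_norm // ltW].
Qed.

(* If [s ^ m] exceeded a multiple of [t], then no polynomial defining the set
   would change sign on [{t} x [s, e]], so that the point [(t, e)] would belong
   to the set as well, against the hypothesis. *)
Lemma semialgebraic_hoelder (f : QE.formula R) :
  (forall e, 0 < e -> exists2 d, 0 < d & forall t s, 0 < t < d -> 0 <= s ->
     QE.holds [:: t; s] f -> s < e) ->
  exists m : nat, exists C d : R, [/\ 0 <= C, 0 < d &
    forall t s, 0 < t < d -> 0 <= s -> QE.holds [:: t; s] f ->
      s ^+ m <= C * t].
Proof.
move=> hsmall; have [ps hps] := holds_sgr f.
have [q q0 hq] := bihorner_sgr_itv ps.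
have [m [C [e [C0 e0 hC]]]] := bihorner_root_bound q0.
have [d d0 hd] := hsmall e e0.
exists m, C, (Num.min d 1); split=> // [|t s /andP[t0]].
  by rewrite lt_min d0 ltr01.
rewrite lt_min => /andP[td t1] s0 hts; rewrite leNgt; apply/negP => hs.
have se : s < e by apply: (hd t) => //; rewrite t0.
have : QE.holds [:: t; e] f.
  apply: hps hts => p hp; apply: (hq t s e t0 (ltW se) _ p hp) => x /andP[sx xe].
  apply/eqP => /hC; rewrite t0 (ltW t1) (le_trans s0 sx) xe => /(_ isT isT).
  by rewrite leNgt (lt_le_trans hs) // lerXn2r ?nnegrE // (le_trans s0 sx).
by move=> /(hd t e _ (ltW e0)); rewrite t0 td ltxx => /(_ isT).
Qed.

(** * The Lojasiewicz inequality for nonnegative polynomial functions *)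

Lemma holds_foldr_Exists (f : QE.formula R) n (e : seq R) :
  QE.holds e (foldr QE.Exists f (iota (size e) n)) <->
  exists2 s : seq R, size s = n & QE.holds (e ++ s) f.
Proof.
elim: n e => [|n IHn] e /=.
  split=> [h|[s /size0nil ->]]; last by rewrite cats0.
  by exists [::]; rewrite ?cats0.
(* The quantified index is the size of the environment, so that each quantifier appends one value at
   the end. *)
have set_last x : set_nth 0 e (size e) x = rcons e x.
  by elim: e {IHn} => //= y e ->.
split=> [[x]|[[//|x s] [sz]]].
  rewrite set_last -(size_rcons e x) => /IHn[s sz h].
  by exists (x :: s); rewrite /= ?sz // -cat_rcons.
rewrite -cat_rcons => h; exists x; rewrite set_last -(size_rcons e x).
by apply/IHn; exists s.
Qed.

Lemma holds_foldr_Forall (f : QE.formula R) n (e : seq R) :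
  QE.holds e (foldr QE.Forall f (iota (size e) n)) <->
  forall s : seq R, size s = n -> QE.holds (e ++ s) f.
Proof.
elim: n e => [|n IHn] e /=.
  by split=> [h s /size0nil ->|/(_ [::] erefl)]; rewrite cats0.
have set_last x : set_nth 0 e (size e) x = rcons e x.
  by elim: e {IHn} => //= y e ->.
split=> [h [//|x s] [sz]|h x].
  rewrite -cat_rcons; move: (h x); rewrite set_last -(size_rcons e x) => /IHn.
  exact.
rewrite set_last -(size_rcons e x); apply/IHn => s sz.
by rewrite cat_rcons; apply: h; rewrite /= sz.
Qed.

(** Polynomials are kept as functions with closure rules: all that is asked of them is a translation
    into terms and continuity. *)
Inductive polyfun n : ('rV[R]_n -> R) -> Prop :=
| polyfunC c : polyfun (fun=> c)
| polyfunX i : polyfun (fun x => x 0 i)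
| polyfunD f g : polyfun f -> polyfun g -> polyfun (fun x => f x + g x)
| polyfunM f g : polyfun f -> polyfun g -> polyfun (fun x => f x * g x).

Lemma polyfunN n (f : 'rV[R]_n -> R) : polyfun f -> polyfun (fun x => - f x).
Proof.
move=> hf; have -> : (fun x => - f x) = (fun x => (-1) * f x).
  by apply/funext => x; rewrite mulN1r.
exact/polyfunM/hf/polyfunC.
Qed.

Lemma polyfun_sum n (I : Type) (r : seq I) (F : I -> 'rV[R]_n -> R) :
  (forall i, polyfun (F i)) -> polyfun (fun x => \sum_(i <- r) F i x).
Proof.
move=> hF; elim: r => [|i r IHr].
  have -> : (fun x => \sum_(i <- [::]) F i x) = (fun=> 0).
    by apply/funext => x; rewrite big_nil.
  exact: polyfunC.
have -> : (fun x => \sum_(i <- i :: r) F i x) =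
    (fun x => F i x + \sum_(i <- r) F i x).
  by apply/funext => x; rewrite big_cons.
exact: polyfunD.
Qed.

(** The coordinates are terms themselves, so that one polynomial can be instantiated at different
    blocks of variables, or at their difference. *)
Lemma polyfun_term n (f : 'rV[R]_n -> R) : polyfun f ->
  exists T : ('I_n -> GRing.term R) -> GRing.term R, forall e v,
    GRing.eval e (T v) = f (\row_i GRing.eval e (v i)).
Proof.
elim=> {f} [c|i|f g _ [F hF] _ [G hG]|f g _ [F hF] _ [G hG]].
- by exists (fun=> GRing.Const c).
- by exists (fun v => v i) => e v; rewrite mxE.
- by exists (fun v => GRing.Add (F v) (G v)) => e v; rewrite /= hF hG.
- by exists (fun v => GRing.Mul (F v) (G v)) => e v; rewrite /= hF hG.
Qed.

Lemma polyfun_continuous n (f : 'rV[R]_n -> R) : polyfun f -> continuous f.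
Proof.
elim=> {f} [c|i|f g _ hf _ hg|f g _ hf _ hg] x.
- exact: (@cst_continuous _ _ c x).
- exact: coord_continuous.
- exact: cvgD (hf x) (hg x).
- exact: cvgM (hf x) (hg x).
Qed.

Definition sqn n (x : 'rV[R]_n) : R := \sum_i x 0 i ^+ 2.

Lemma sqn_ge0 n (x : 'rV[R]_n) : 0 <= sqn x.
Proof. by apply: sumr_ge0 => i _; exact: sqr_ge0. Qed.

Lemma sqn0 n : sqn (0 : 'rV[R]_n) = 0.
Proof. by apply: big1 => i _; rewrite mxE expr0n. Qed.

Lemma sqnB_le n (x y : 'rV[R]_n) : sqn (x - y) <= 2 * (sqn x + sqn y).
Proof.
rewrite /sqn -big_split /= mulr_sumr; apply: ler_sum => i _; rewrite !mxE.
rewrite -subr_ge0.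
have -> : 2 * (x 0 i ^+ 2 + y 0 i ^+ 2) - (x 0 i - y 0 i) ^+ 2 =
  (x 0 i + y 0 i) ^+ 2 by ring.
exact: sqr_ge0.
Qed.

Lemma polyfun_sqnB n (y : 'rV[R]_n) : polyfun (fun x => sqn (x - y)).
Proof.
apply: polyfun_sum => i.
have -> : (fun x : 'rV[R]_n => (x - y) 0 i ^+ 2) =
    (fun x => (x 0 i + - y 0 i) * (x 0 i + - y 0 i)).
  by apply/funext => x; rewrite !mxE expr2.
by apply: polyfunM; apply: polyfunD; (exact: polyfunX || exact: polyfunC).
Qed.

Lemma polyfun_sqn n : polyfun (@sqn n).
Proof.
have -> : @sqn n = (fun x => sqn (x - 0)) by apply/funext => x; rewrite subr0.
exact: polyfun_sqnB.
Qed.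

Lemma row_of_seq n (x : 'rV[R]_n) (e e' : seq R) :
  (\row_i nth 0 (e ++ [seq x 0 j | j <- enum 'I_n] ++ e') (size e + i)) = x.
Proof.
apply/rowP => i; rewrite mxE nth_cat ltnNge leq_addr /= addKn nth_cat.
rewrite size_map size_enum_ord ltn_ord (nth_map i) ?size_enum_ord //.
by rewrite nth_ord_enum.
Qed.

(** Speaking of lower bounds [s] of the squared distance, rather than of the distance, keeps the
    formula to one existential and one universal block, without an infimum or a square root. *)
Lemma sublevel_distance_definable n (p : 'rV[R]_n -> R) (rho : R) :
  polyfun p -> exists f : QE.formula R, forall t s,
    QE.holds [:: t; s] f <-> exists x, [/\ sqn x <= rho, p x = t &
      forall y, p y = 0 -> s <= sqn (x - y)].
Proof.
move=> hp; have [P hP] := polyfun_term hp.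
have [D hD] := polyfun_term (polyfun_sqn n).
(* Variables 0 and 1 are [t] and [s]; the next [n] are the coordinates of [x], and the last [n]
   those of [y]. *)
pose vx (i : 'I_n) := GRing.Var R (2 + i).
pose vy (i : 'I_n) := GRing.Var R (2 + n + i).
pose vd (i : 'I_n) := GRing.Add (vx i) (GRing.Opp (vy i)).
pose fy := QE.Implies (QE.Equal (P vy) (GRing.Const 0))
                      (QE.Le (GRing.Var R 1) (D vd)).
pose fx := QE.And (QE.Le (D vx) (GRing.Const rho))
    (QE.And (QE.Equal (P vx) (GRing.Var R 0))
            (foldr QE.Forall fy (iota (2 + n) n))).
exists (foldr QE.Exists fx (iota 2 n)) => t s.
have fyP (xs ys : seq R) : size xs = n ->
    QE.holds ([:: t; s] ++ xs ++ ys) fy <->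
    (p (\row_i nth 0 ([:: t; s] ++ xs ++ ys) (2 + n + i)) = 0 ->
     s <= sqn (\row_(i < n) nth 0 ([:: t; s] ++ xs ++ ys) (2 + i) -
               \row_(i < n) nth 0 ([:: t; s] ++ xs ++ ys) (2 + n + i))).
  move=> _; rewrite /fy /= hP hD.
  set a := \row_i _; set b := \row_i _; set c := \row_i _.
  by have -> : b = c - a by apply/rowP => i; rewrite !mxE.
have seqE (zs : seq R) : size zs = n ->
    zs = [seq (\row_i zs`_i : 'rV[R]_n) 0 j | j <- enum 'I_n].
  move=> sz; apply: (@eq_from_nth _ 0) => [|i]; first by rewrite size_map size_enum_ord.
  rewrite sz => ilt; rewrite (nth_map (Ordinal ilt)) ?size_enum_ord // mxE.
  by rewrite (nth_ord_enum _ (Ordinal ilt)).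
split.
- move/(holds_foldr_Exists fx n [:: t; s]) => [xs szx] [hx1 [hx2 hx3]].
  pose x : 'rV[R]_n := \row_i xs`_i.
  have xE : \row_i GRing.eval ([:: t; s] ++ xs) (vx i) = x.
    by apply/rowP => i; rewrite !mxE.
  exists x; split.
  + by move: hx1; rewrite /= hD xE.
  + by move: hx2; rewrite /= hP xE.
  + move=> y py0; have szx' : size ([:: t; s] ++ xs) = 2 + n by rewrite /= szx.
    have := (holds_foldr_Forall fy n ([:: t; s] ++ xs)).1.
    rewrite szx' => /(_ hx3 [seq y 0 j | j <- enum 'I_n]).
    rewrite size_map size_enum_ord -catA => /(_ erefl) /(fyP _ _ szx).
    have := row_of_seq y ([:: t; s] ++ xs) [::]; rewrite cats0 szx' -catA => ->.
    rewrite {1}(seqE xs szx).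
    have := row_of_seq x [:: t; s] [seq y 0 j | j <- enum 'I_n] => -> /=.
    exact.
- move=> [x [hx1 hx2 hx3]]; apply/(holds_foldr_Exists fx n [:: t; s]).
  have szx : size [seq x 0 j | j <- enum 'I_n] = n by rewrite size_map size_enum_ord.
  exists [seq x 0 j | j <- enum 'I_n]; first exact: szx.
  have xE : \row_i GRing.eval ([:: t; s] ++ [seq x 0 j | j <- enum 'I_n]) (vx i) = x.
    by have := row_of_seq x [:: t; s] [::]; rewrite cats0.
  split; first by rewrite /= hD xE.
  split; first by rewrite /= hP xE.
  have szx' : size ([:: t; s] ++ [seq x 0 j | j <- enum 'I_n]) = 2 + n.
    by rewrite size_cat szx.
  have := (holds_foldr_Forall fy n ([:: t; s] ++ [seq x 0 j | j <- enum 'I_n])).2.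
  rewrite szx'; apply=> ys szy; rewrite -catA.
  apply/fyP => //.
  rewrite (row_of_seq x [:: t; s] ys); set y := \row_i _.
  exact: hx3.
Qed.

Lemma compact_sqn_le n (rho : R) : compact [set x : 'rV[R]_n | sqn x <= rho]%classic.
Proof.
apply: bounded_closed_compact; last first.
  apply: ((continuous_closedP (@sqn n)).1 _ [set z | z <= rho]%classic).
    exact: polyfun_continuous (polyfun_sqn n).
  exact: closed_le.
exists (1 + rho); split; first exact: num_real.
move=> M hM x /= hx; have M0 : 0 <= M.
  by rewrite (le_trans _ (ltW hM)) // addr_ge0 // (le_trans (sqn_ge0 x)).
rewrite [`|x|]mx_normrE; apply: bigmax_le => // -[i j] _ /=.
rewrite (le_trans _ (ltW hM)) // (@le_trans _ _ (1 + x i j ^+ 2)) //.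
  rewrite -[x i j ^+ 2]real_normK ?num_real // -subr_ge0.
  have -> : 1 + `|x i j| ^+ 2 - `|x i j| = (`|x i j| - 2^-1) ^+ 2 + 3 / 4 by field.
  by rewrite addr_ge0 ?sqr_ge0.
rewrite lerD2l (le_trans _ hx) // /sqn (bigD1 j) //= ord1 lerDl.
by apply: sumr_ge0 => k _; exact: sqr_ge0.
Qed.

(** By compactness [p] attains its minimum over the points of the ball that are at squared distance
    at least [e] from all zeros. This minimum is positive, since a zero is at distance 0 from
    itself. *)
Lemma polyfun_small n (p : 'rV[R]_n -> R) (rho e : R) : polyfun p ->
  (forall x, 0 <= p x) -> 0 < e -> exists2 d, 0 < d &
    forall x s, sqn x <= rho -> p x < d ->
      (forall y, p y = 0 -> s <= sqn (x - y)) -> s < e.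
Proof.
move=> hp p0 e0.
pose S := [set x : 'rV[R]_n | sqn x <= rho /\ forall y, p y = 0 -> e <= sqn (x - y)]%classic.
have [S0|SN0] := pselect (S !=set0)%classic; last first.
  exists 1 => // x s hx _ hs; rewrite ltNge; apply/negP => es; apply: SN0.
  by exists x; split=> // y /hs; apply: le_trans.
have Scp : compact S.
  have -> : S = ([set x | sqn x <= rho] `&`
      \bigcap_(y in [set y | p y = 0]) [set x | e <= sqn (x - y)])%classic.
    by apply/seteqP; split=> x [].
  apply: compact_closedI; first exact: compact_sqn_le.
  apply: closed_bigI => y _.
  have cs := polyfun_continuous (polyfun_sqnB y).
  exact: (continuous_closedP _).1 cs [set z | e <= z]%classic (@closed_ge _ e).
have cp : {within S, continuous p}%classic.
  by apply: continuous_subspaceT; exact: polyfun_continuous.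
have [c cS hc] := compact_EVT_min S0 Scp cp.
exists (p c).
  rewrite lt_neqAle p0 andbT eq_sym; apply/eqP => pc0.
  by have := (set_mem cS).2 c pc0; rewrite subrr sqn0 leNgt e0.
move=> x s hx px hs; rewrite ltNge; apply/negP => es.
have := hc x; rewrite leNgt px => h; apply: notF; apply: h.
by rewrite inE; split=> // y /hs; apply: le_trans.
Qed.

(** The definable set knows lower bounds of the squared distance, not a nearest zero. The zero [y]
    is therefore found by contradiction: a suitable [s] is too large to be such a lower bound. *)
Lemma lojasiewicz n (p : 'rV[R]_n -> R) (rho : R) : polyfun p ->
  (forall x, 0 <= p x) -> (exists y, p y = 0) ->
  exists m : nat, exists2 C : R, 0 <= C &
    forall x, sqn x <= rho ->
      exists2 y, p y = 0 & sqn (x - y) ^+ m.+1 <= C * p x.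
Proof.
move=> hp p0 [y0 py0].
have [f hf] := sublevel_distance_definable rho hp.
have [|m [C [d [C0 d0 hC]]]] := @semialgebraic_hoelder f.
  move=> e e0; have [d d0 hd] := polyfun_small rho hp p0 e0.
  exists d => // t s /andP[t0 td] s0 /hf [x [hx px hs]].
  by apply: (hd x) => //; rewrite px.
have [d1 d10 hd1] := polyfun_small rho hp p0 ltr01.
pose d2 := Num.min d d1.
have d20 : 0 < d2 by rewrite lt_min d0.
pose D := 2 * (rho + sqn y0).
(* The first summand covers the points with [p x >= d2], for which the fixed zero [y0] is good
   enough. The absolute value is there because the sign of [rho] is not known before a point is
   given. *)
exists m, (`|D| ^+ m.+1 / d2 + (C + 1)).
  by rewrite !addr_ge0 // divr_ge0 ?exprn_ge0 // ltW.
move=> x hx; have [t0|t0] := eqVneq (p x) 0.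
  by exists x; rewrite // subrr sqn0 expr0n t0 mulr0.
have {}t0 : 0 < p x by rewrite lt_neqAle eq_sym t0 p0.
have [tlt|tge] := ltP (p x) d2; last first.
  exists y0 => //; rewrite mulrDl (@le_trans _ _ (`|D| ^+ m.+1 / d2 * p x)) //.
    rewrite (@le_trans _ _ (`|D| ^+ m.+1)) //.
      rewrite lerXn2r ?nnegrE ?sqn_ge0 // (le_trans (sqnB_le _ _)) //.
      by rewrite (le_trans _ (ler_norm _)) // ler_pM2l // lerD2r.
    by rewrite -mulrA ler_peMr ?exprn_ge0 // mulrC ler_pdivlMr ?mul1r.
  by rewrite lerDl mulr_ge0 // addr_ge0.
move: tlt; rewrite lt_min => /andP[td td1].
(* If this [s] bounded all squared distances from below, then [s < 1] and [s ^+ m >= s ^+ m.+1 = (C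
   + 1) * p x > C * p x], against [hC]. The exponent [m.+1] makes the root meaningful for [m = 0]
   too, and [C + 1] makes the inequality strict. *)
pose s := ((C + 1) * p x) `^ (m.+1%:R^-1).
have s0 : 0 <= s by exact: powR_ge0.
have K0 : 0 < (C + 1) * p x by rewrite mulr_gt0 // ltr_pwDr.
have sm : s ^+ m.+1 = (C + 1) * p x.
  by rewrite -powR_mulrn // -powRrM mulVf ?pnatr_eq0 // powRr1 // ltW.
have [hy|hy] := pselect (exists2 y, p y = 0 & sqn (x - y) < s).
  have [y py ys] := hy; exists y => //.
  rewrite (@le_trans _ _ (s ^+ m.+1)) ?lerXn2r ?nnegrE ?sqn_ge0 // ?(ltW ys) // sm.
  by rewrite ler_wpM2r ?(ltW t0) // lerDr divr_ge0 ?exprn_ge0 // ltW.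
have hs y : p y = 0 -> s <= sqn (x - y).
  by move=> py; rewrite leNgt; apply/negP => ?; apply: hy; exists y.
have s1 := hd1 x s hx td1 hs.
have : s ^+ m <= C * p x.
  by apply: hC; rewrite ?t0 //; apply/hf; exists x.
suff : C * p x < s ^+ m by rewrite ltNge => /negbTE ->.
rewrite (@lt_le_trans _ _ (s ^+ m.+1)) //; last first.
  by rewrite exprS ler_piMl ?exprn_ge0 // ltW.
by rewrite sm mulrDl mul1r ltrDl.
Qed.
End Lojasiewicz.

(** * Complex moduli as real numbers *)

Section ComplexNorm.
Variable R : realType.
Implicit Types z w : R[i].

Lemma ReD z w : complex.Re (z + w) = complex.Re z + complex.Re w.
Proof. by case: z; case: w. Qed.

Lemma ReN z : complex.Re (- z) = - complex.Re z.
Proof. by case: z. Qed.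

Lemma ReB z w : complex.Re (z - w) = complex.Re z - complex.Re w.
Proof. by rewrite ReD ReN. Qed.

Lemma ReCM (x : R) z : complex.Re (x%:C * z) = x * complex.Re z.
Proof. by case: z => a b /=; rewrite mul0r subr0. Qed.

Lemma Re_sum (I : Type) (r : seq I) (P : pred I) (F : I -> R[i]) :
  complex.Re (\sum_(i <- r | P i) F i) = \sum_(i <- r | P i) complex.Re (F i).
Proof. by apply: (big_morph (@complex.Re R) ReD). Qed.

Lemma Re_ge0 z : 0 <= z -> 0 <= complex.Re z.
Proof. by rewrite lecE => /andP[]. Qed.

(** The norm of [R[i]] takes its values in [R[i]]; this is the same modulus as an element of the
    ordered field [R]. *)
Definition nc z : R := complex.Re `|z|.

Lemma ncE z : `|z| = (nc z)%:C.
Proof. by rewrite /nc normc_def. Qed.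

Lemma nc_ge0 z : 0 <= nc z.
Proof. exact: Re_ge0. Qed.

Lemma nc0 : nc 0 = 0.
Proof. by rewrite /nc normr0. Qed.

Lemma nc_eq0 z : nc z = 0 -> z = 0.
Proof. by move=> h; apply/eqP; rewrite -normr_eq0 ncE h. Qed.

Lemma ncD z w : nc (z + w) <= nc z + nc w.
Proof. by rewrite /nc -ReD; have := ler_normD z w; rewrite lecE => /andP[]. Qed.

Lemma ncM z w : nc (z * w) = nc z * nc w.
Proof. by rewrite {1}/nc normrM !ncE -rmorphM. Qed.

Lemma ncN z : nc (- z) = nc z.
Proof. by rewrite /nc normrN. Qed.

Lemma ncC (x : R) : nc x%:C = `|x|.
Proof. by rewrite /nc normc_def /= expr0n addr0 sqrtr_sqr. Qed.

Lemma nc_conj z : nc z^*%R = nc z.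
Proof. by rewrite /nc norm_conjC. Qed.

Lemma ler_Re_nc z : `|complex.Re z| <= nc z.
Proof. by have := normc_ge_Re z; rewrite ncE lecR. Qed.

Lemma ler_Im_nc z : `|complex.Im z| <= nc z.
Proof.
rewrite /nc normc_def /= -sqrtr_sqr ler_wsqrtr // lerDr; exact: sqr_ge0.
Qed.

Lemma nc_le z : nc z <= `|complex.Re z| + `|complex.Im z|.
Proof.
rewrite {1}(complexE z) (le_trans (ncD _ _)) // ncM !ncC.
suff -> : nc 'i = 1 by rewrite mul1r.
by rewrite /nc normc_def /= expr0n expr1n add0r sqrtr1.
Qed.

Lemma nc_sum (I : Type) (r : seq I) (P : pred I) (F : I -> R[i]) :
  nc (\sum_(i <- r | P i) F i) <= \sum_(i <- r | P i) nc (F i).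
Proof.
elim/big_rec2: _ => [|i y z _ h]; first by rewrite nc0.
by rewrite (le_trans (ncD _ _)) // lerD2l.
Qed.

Lemma mulJ_nc z : z * z^*%R = (nc z ^+ 2)%:C.
Proof. by rewrite rmorphXn /= -ncE normCK. Qed.
End ComplexNorm.

(* Locked, like [ld], [covH] and [cov] below: unification would otherwise unfold
   matrix products whenever it compares two such terms. *)
HB.lock Definition l1 (R : realType) m n (A : 'M[R[i]]_(m, n)) : R :=
  \sum_i \sum_j nc (A i j).
HB.lock Definition retr (R : realType) n (A : 'M[R[i]]_n) : R :=
  complex.Re (\tr A).

(** * The entrywise norm and the real part of the trace *)

Section EntrywiseNorm.
Variable R : realType.
Local Notation C := R[i].

Lemma l1_ge0 m n (A : 'M[C]_(m, n)) : 0 <= l1 A.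
Proof. by rewrite l1.unlock; do 2![apply: sumr_ge0 => ? _]; exact: nc_ge0. Qed.

Lemma l1_entry m n (A : 'M[C]_(m, n)) i j : nc (A i j) <= l1 A.
Proof.
rewrite l1.unlock (bigD1 i) //= (bigD1 j) //= -addrA lerDl.
by rewrite addr_ge0 //; do ?[apply: sumr_ge0 => ? _]; exact: nc_ge0.
Qed.

Lemma l1_eq0 m n (A : 'M[C]_(m, n)) : l1 A = 0 -> A = 0.
Proof.
move=> h; apply/matrixP => i j; rewrite mxE; apply: nc_eq0.
by apply: le_anti; rewrite nc_ge0 -h l1_entry.
Qed.

Lemma l1_0 m n : l1 (0 : 'M[C]_(m, n)) = 0.
Proof. by rewrite l1.unlock; do 2![apply: big1 => ? _]; rewrite mxE nc0. Qed.

Lemma l1D m n (A B : 'M[C]_(m, n)) : l1 (A + B) <= l1 A + l1 B.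
Proof.
rewrite l1.unlock -big_split; apply: ler_sum => i _; rewrite -big_split.
by apply: ler_sum => j _; rewrite mxE ncD.
Qed.

Lemma l1N m n (A : 'M[C]_(m, n)) : l1 (- A) = l1 A.
Proof. by rewrite l1.unlock; do 2![apply: eq_bigr => ? _]; rewrite mxE ncN. Qed.

Lemma l1B m n (A B : 'M[C]_(m, n)) : l1 (A - B) = l1 (B - A).
Proof. by rewrite -opprB l1N. Qed.

Lemma l1_sum (I : Type) (r : seq I) (P : pred I) m n (F : I -> 'M[C]_(m, n)) :
  l1 (\sum_(i <- r | P i) F i) <= \sum_(i <- r | P i) l1 (F i).
Proof.
elim/big_rec2: _ => [|i y z _ h]; first by rewrite l1_0.
by rewrite (le_trans (l1D _ _)) // lerD2l.
Qed.

Lemma l1Z m n (x : R) (A : 'M[C]_(m, n)) : l1 (x%:C *: A) = `|x| * l1 A.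
Proof.
rewrite l1.unlock mulr_sumr; apply: eq_bigr => i _; rewrite mulr_sumr.
by apply: eq_bigr => j _; rewrite mxE ncM ncC.
Qed.

Lemma l1_adj m n (A : 'M[C]_(m, n)) : l1 (A^t*) = l1 A.
Proof.
rewrite l1.unlock exchange_big; apply: eq_bigr => i _; apply: eq_bigr => j _.
by rewrite !mxE nc_conj.
Qed.

Lemma l1M m n p (A : 'M[C]_(m, n)) (B : 'M[C]_(n, p)) :
  l1 (A *m B) <= l1 A * l1 B.
Proof.
rewrite l1.unlock mulr_suml; apply: ler_sum => i _.
apply: (@le_trans _ _ (\sum_j \sum_k nc (A i k) * nc (B k j))).
  apply: ler_sum => j _; rewrite mxE (le_trans (nc_sum _ _ _)) //.
  by apply: ler_sum => k _; rewrite ncM.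
rewrite exchange_big mulr_suml; apply: ler_sum => k _ /=.
rewrite -mulr_sumr ler_wpM2l ?nc_ge0 // (bigD1 k) //= lerDl.
by do 2![apply: sumr_ge0 => ? _]; exact: nc_ge0.
Qed.

Lemma retrD n (A B : 'M[C]_n) : retr (A + B) = retr A + retr B.
Proof. by rewrite retr.unlock mxtraceD ReD. Qed.

Lemma retrN n (A : 'M[C]_n) : retr (- A) = - retr A.
Proof. by rewrite retr.unlock -scaleN1r mxtraceZ mulN1r ReN. Qed.

Lemma retr0 n : retr (0 : 'M[C]_n) = 0.
Proof. by rewrite retr.unlock mxtrace0. Qed.

Lemma retrB n (A B : 'M[C]_n) : retr (A - B) = retr A - retr B.
Proof. by rewrite retrD retrN. Qed.

Lemma retr_sum (I : Type) (r : seq I) (P : pred I) n (F : I -> 'M[C]_n) :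
  retr (\sum_(i <- r | P i) F i) = \sum_(i <- r | P i) retr (F i).
Proof. by apply: (big_morph (@retr R n) (@retrD n)); rewrite retr.unlock mxtrace0. Qed.

Lemma retrZ n (x : R) (A : 'M[C]_n) : retr (x%:C *: A) = x * retr A.
Proof. by rewrite retr.unlock mxtraceZ ReCM. Qed.

Lemma retr_mulC m n (A : 'M[C]_(m, n)) (B : 'M[C]_(n, m)) :
  retr (A *m B) = retr (B *m A).
Proof. by rewrite retr.unlock mxtrace_mulC. Qed.

Lemma retr1 n : retr (1%:M : 'M[C]_n) = n%:R.
Proof. by rewrite retr.unlock mxtrace1 -[n%:R](rmorph_nat (real_complex R)). Qed.

Lemma retr_le n (A : 'M[C]_n) : `|retr A| <= l1 A.
Proof.
rewrite retr.unlock l1.unlock /mxtrace Re_sum (le_trans (ler_norm_sum _ _ _)) //.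
apply: ler_sum => i _; rewrite (le_trans (ler_Re_nc _)) // (bigD1 i) //= lerDl.
by apply: sumr_ge0 => ? _; exact: nc_ge0.
Qed.

Lemma retr_gram m n (A : 'M[C]_(m, n)) :
  retr (A *m A^t*) = \sum_i \sum_j nc (A i j) ^+ 2.
Proof.
rewrite retr.unlock /mxtrace Re_sum; apply: eq_bigr => i _.
rewrite mxE Re_sum; apply: eq_bigr => j _.
by rewrite !mxE mulJ_nc.
Qed.

Lemma gram_eq0 m n (A : 'M[C]_(m, n)) : retr (A *m A^t*) = 0 -> A = 0.
Proof.
rewrite retr_gram => /eqP; rewrite psumr_eq0; last first.
  by move=> i _; apply: sumr_ge0 => j _; exact: sqr_ge0.
move=> /allP h; apply/matrixP => i j; rewrite mxE; apply: nc_eq0.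
have := h i (mem_index_enum _); rewrite /= psumr_eq0; last first.
  by move=> k _; exact: sqr_ge0.
by move=> /allP/(_ j (mem_index_enum _)); rewrite /= sqrf_eq0 => /eqP.
Qed.

Lemma ler_sqr1 (x y : R) : x ^+ 2 <= y -> x <= 1 + y.
Proof.
move=> h; have := sqr_ge0 (x - 2^-1); rewrite -subr_ge0.
have -> : (x - 2^-1) ^+ 2 = x ^+ 2 - x + 1 / 4 by field.
lra.
Qed.

(** Each modulus is bounded through [x <= 1 + x ^ 2]; the bound is crude but free of square roots,
    and it serves only to keep factors bounded. *)
Lemma l1_le_gram m n (A : 'M[C]_(m, n)) :
  l1 A <= m%:R * n%:R * (1 + retr (A *m A^t*)).
Proof.
rewrite (@le_trans _ _ (\sum_(i < m) \sum_(j < n) (1 + retr (A *m A^t*)))) //.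
  rewrite l1.unlock; apply: ler_sum => i _; apply: ler_sum => j _.
  apply: ler_sqr1.
  rewrite retr_gram (bigD1 i) //= (bigD1 j) //= -addrA lerDl.
  by rewrite addr_ge0 //; do ?[apply: sumr_ge0 => ? _]; exact: sqr_ge0.
by rewrite !sumr_const !card_ord -mulrA !mulr_natl.
Qed.

End EntrywiseNorm.

(** * Positive semidefinite matrices: spectral form, factors, pencils *)

Section PositiveSemidefinite.
Variable R : realType.
Local Notation C := R[i].

Lemma adjM m n p (A : 'M[C]_(m, n)) (B : 'M[C]_(n, p)) :
  (A *m B)^t* = B^t* *m A^t*.
Proof. by rewrite trmx_mul map_mxM. Qed.

Lemma adjK m n (A : 'M[C]_(m, n)) : A^t*^t* = A.
Proof. exact: trmxCK. Qed.

Lemma adjD m n (A B : 'M[C]_(m, n)) : (A + B)^t* = A^t* + B^t*.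
Proof. by rewrite linearD /= map_mxD. Qed.

Lemma adjN m n (A : 'M[C]_(m, n)) : (- A)^t* = - A^t*.
Proof. by rewrite linearN /= map_mxN. Qed.

Lemma adjB m n (A B : 'M[C]_(m, n)) : (A - B)^t* = A^t* - B^t*.
Proof. by rewrite adjD adjN. Qed.

Lemma conjC_real (x : R) : (x%:C)^*%R = x%:C :> C.
Proof. by apply/CrealP; rewrite complex_real. Qed.

Lemma adjZ m n (x : R) (A : 'M[C]_(m, n)) : (x%:C *: A)^t* = x%:C *: A^t*.
Proof. by apply/matrixP => i j; rewrite !mxE rmorphM /= conjC_real. Qed.

Lemma adj1 n : (1%:M : 'M[C]_n)^t* = 1%:M.
Proof. by rewrite trmx1 map_mx1. Qed.

Lemma hermE n (A : 'M[C]_n) : (A \is hermsymmx) <-> A^t* = A.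
Proof.
split=> [/is_hermitianmxP|h]; first by rewrite expr0 scale1r.
by apply/is_hermitianmxP; rewrite expr0 scale1r.
Qed.

Lemma psdmx_adj n (A : 'M[C]_n) : psdmx A -> A^t* = A.
Proof. by case=> /hermE. Qed.

Lemma psdmx_gram m n (B : 'M[C]_(n, m)) : psdmx (B *m B^t*).
Proof.
split; first by apply/hermE; rewrite adjM adjK.
move=> x; rewrite mulmxA -[x^t* *m B](adjK) adjM adjK -mulmxA.
set y := B^t* *m x; rewrite mxE; apply: sumr_ge0 => i _.
by rewrite !mxE mulrC; exact: mul_conjC_ge0.
Qed.

Lemma psdmx_conj m n (A : 'M[C]_n) (B : 'M[C]_(m, n)) :
  psdmx A -> psdmx (B *m A *m B^t*).
Proof.
move=> [/hermE hA pA]; split.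
  by apply/hermE; rewrite !adjM adjK hA mulmxA.
move=> x; have := pA (B^t* *m x); rewrite adjM adjK.
by rewrite !mulmxA.
Qed.

Lemma psdmx_diag n (A : 'M[C]_n) i : psdmx A -> 0 <= A i i.
Proof.
move=> [_ /(_ (delta_mx i 0))].
rewrite trmx_delta map_delta_mx.
by rewrite -rowE -colE !mxE.
Qed.

Lemma psdmxD n (A B : 'M[C]_n) : psdmx A -> psdmx B -> psdmx (A + B).
Proof.
move=> [/hermE hA pA] [/hermE hB pB]; split.
  by apply/hermE; rewrite adjD hA hB.
by move=> x; rewrite mulmxDr mulmxDl mxE addr_ge0.
Qed.

Lemma psdmx0 n : psdmx (0 : 'M[C]_n).
Proof. by have := psdmx_gram (0 : 'M[C]_n); rewrite mul0mx. Qed.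

Lemma psdmx1 n : psdmx (1%:M : 'M[C]_n).
Proof. by have := psdmx_gram (1%:M : 'M[C]_n); rewrite adj1 mulmx1. Qed.

Lemma psdmxZ n (x : R) (A : 'M[C]_n) : 0 <= x -> psdmx A -> psdmx (x%:C *: A).
Proof.
move=> x0 [/hermE hA pA]; split; first by apply/hermE; rewrite adjZ hA.
by move=> v; rewrite -scalemxAr -scalemxAl mxE mulr_ge0 // lecR.
Qed.

Lemma psdmx_sum (I : Type) (r : seq I) (P : pred I) n (F : I -> 'M[C]_n) :
  (forall i, psdmx (F i)) -> psdmx (\sum_(i <- r | P i) F i).
Proof.
move=> h; apply: (big_ind (@psdmx R n)) => [|A B|i _]; last exact: h.
  exact: psdmx0.
exact: psdmxD.
Qed.

Definition rdiag n (d : 'I_n -> R) : 'M[C]_n := diag_mx (\row_i (d i)%:C).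

Lemma rdiagM n (d e : 'I_n -> R) :
  rdiag d *m rdiag e = rdiag (fun i => d i * e i).
Proof.
rewrite mulmx_diag; congr diag_mx; apply/rowP => i.
by rewrite !mxE rmorphM.
Qed.

Lemma rdiagD n (d e : 'I_n -> R) :
  rdiag d + rdiag e = rdiag (fun i => d i + e i).
Proof.
rewrite -linearD; congr diag_mx; apply/rowP => i.
by rewrite !mxE rmorphD.
Qed.

Lemma rdiagB n (d e : 'I_n -> R) :
  rdiag d - rdiag e = rdiag (fun i => d i - e i).
Proof.
rewrite -linearB; congr diag_mx; apply/rowP => i.
by rewrite !mxE rmorphB.
Qed.

Lemma rdiag1 n : rdiag (fun=> 1 : R) = 1%:M :> 'M[C]_n.
Proof.
by rewrite -diag_const_mx; congr diag_mx; apply/rowP => i; rewrite !mxE.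
Qed.

Lemma rdiag_adj n (d : 'I_n -> R) : (rdiag d)^t* = rdiag d.
Proof.
rewrite tr_diag_mx map_diag_mx; congr diag_mx; apply/rowP => i.
by rewrite !mxE; exact: conjC_real.
Qed.

Lemma rdiagE n (d : 'I_n -> R) i j : rdiag d i j = (d i *+ (i == j))%:C.
Proof. by rewrite !mxE; case: eqP => [->|]. Qed.

Lemma retr_rdiag n (d : 'I_n -> R) : retr (rdiag d) = \sum_i d i.
Proof.
by rewrite retr.unlock mxtrace_diag Re_sum; apply: eq_bigr => i _; rewrite mxE.
Qed.

Lemma l1_rdiag n (d : 'I_n -> R) : l1 (rdiag d) = \sum_i `|d i|.
Proof.
rewrite l1.unlock; apply: eq_bigr => i _; rewrite (bigD1 i) //= big1 => [|j ji].
  by rewrite addr0 rdiagE eqxx ncC.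
by rewrite rdiagE eq_sym (negbTE ji) nc0.
Qed.

Lemma det_rdiag n (d : 'I_n -> R) : \det (rdiag d) = (\prod_i d i)%:C.
Proof. by rewrite det_diag rmorph_prod; apply: eq_bigr => i _; rewrite mxE. Qed.

Lemma herm_rdiag n (A : 'M[C]_n) : A^t* = A ->
  exists U (d : 'I_n -> R), [/\ U *m U^t* = 1%:M, U^t* *m U = 1%:M &
    A = U *m rdiag d *m U^t*].
Proof.
move=> /hermE hA; have /orthomx_spectralP := hermitian_normalmx hA.
have Pu := spectral_unitarymx A; rewrite invmx_unitary // => AE.
have PP := unitarymxP Pu; have PP' := mulmx1C PP.
exists ((spectralmx A)^t*), (fun i => complex.Re (spectral_diag A 0 i)).
rewrite adjK; split; [exact: PP' | exact: PP |].
have -> : rdiag (fun i => complex.Re (spectral_diag A 0 i)) =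
    diag_mx (spectral_diag A); last exact: AE.
congr diag_mx; apply/rowP => i; rewrite mxE RRe_real //.
by have /mxOverP := hermitian_spectral_diag_real hA; exact.
Qed.

Lemma rdiag_conj n (A U : 'M[C]_n) (d : 'I_n -> R) : U^t* *m U = 1%:M ->
  A = U *m rdiag d *m U^t* -> rdiag d = U^t* *m A *m U.
Proof.
move=> UU ->; rewrite !mulmxA UU mul1mx -mulmxA UU mulmx1 //.
Qed.

Lemma psdmx_rdiag n (A : 'M[C]_n) : psdmx A ->
  exists U (d : 'I_n -> R), [/\ U *m U^t* = 1%:M, U^t* *m U = 1%:M,
    A = U *m rdiag d *m U^t* & forall i, 0 <= d i].
Proof.
move=> pA; have [U [d [UU UU' AE]]] := herm_rdiag (psdmx_adj pA).
exists U, d; split=> // i.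
have := psdmx_diag i (psdmx_conj (U^t*) pA).
by rewrite adjK -(rdiag_conj UU' AE) rdiagE eqxx lecR.
Qed.

Lemma psdmx_factor n (A : 'M[C]_n) : psdmx A ->
  exists B : 'M[C]_n, A = B *m B^t*.
Proof.
move=> /psdmx_rdiag [U [d [_ _ -> d0]]].
exists (U *m rdiag (fun i => Num.sqrt (d i))).
rewrite adjM rdiag_adj mulmxA -[in RHS](mulmxA U) rdiagM.
have -> // : (fun i => Num.sqrt (d i) * Num.sqrt (d i)) = d.
by apply/funext => i; rewrite -expr2 sqr_sqrtr.
Qed.

Lemma retr_psd_ge0 n (A : 'M[C]_n) : psdmx A -> 0 <= retr A.
Proof.
move=> pA; rewrite retr.unlock /mxtrace Re_sum; apply: sumr_ge0 => i _.
exact/Re_ge0/psdmx_diag.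
Qed.

(** In terms of a factor [B], an entry is an inner product of two rows, so its modulus is at most
    the mean of two diagonal entries, each of which is at most the trace. *)
Lemma l1_psd_le n (A : 'M[C]_n) : psdmx A -> l1 A <= n%:R * n%:R * retr A.
Proof.
move=> pA; have [B AE] := psdmx_factor pA.
rewrite (@le_trans _ _ (\sum_(i < n) \sum_(j < n) retr A)) //; last first.
  by rewrite !sumr_const !card_ord -mulrA !mulr_natl.
have lE : l1 A = \sum_i \sum_j nc (A i j) by rewrite l1.unlock.
have row_le i : \sum_k nc (B i k) ^+ 2 <= retr A.
  rewrite AE retr_gram [leRHS](bigD1 i) //= lerDl.
  by do 2![apply: sumr_ge0 => ? _]; exact: sqr_ge0.
rewrite lE; apply: ler_sum => i _; apply: ler_sum => j _.
rewrite AE mxE (le_trans (nc_sum _ _ _)) //.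
rewrite (@le_trans _ _ (\sum_k (nc (B i k) ^+ 2 / 2 + nc (B j k) ^+ 2 / 2))) //.
  apply: ler_sum => k _; rewrite !mxE ncM nc_conj.
  have := sqr_ge0 (nc (B i k) - nc (B j k)); rewrite sqrrB; lra.
by rewrite big_split /= -!mulr_suml -AE; have := row_le i; have := row_le j; lra.
Qed.

(** The eigenvalues of [X] are at least 1, so the inverse of the factor is bounded independently of
    [X]. *)
Lemma pd_factor n (X : 'M[C]_n) : psdmx (X - 1%:M) ->
  exists S Si : 'M[C]_n, [/\ S *m Si = 1%:M, X = S *m S^t* &
    retr (Si *m Si^t*) <= n%:R].
Proof.
move=> pX; have [U [x [UU UU' XE x0]]] := psdmx_rdiag pX.
pose r i := Num.sqrt (1 + x i).
have r0 i : 0 < r i by rewrite sqrtr_gt0 ltr_pwDl.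
have rr i : r i * r i = 1 + x i by rewrite -expr2 sqr_sqrtr // addr_ge0.
exists (U *m rdiag r), (rdiag (fun i => (r i)^-1) *m U^t*); split.
- rewrite mulmxA -(mulmxA U) rdiagM.
  have -> : (fun i => r i * (r i)^-1) = (fun=> 1).
    by apply/funext => i; rewrite mulfV // gt_eqF.
  by rewrite rdiag1 mulmx1.
- have -> : X = U *m (rdiag x + rdiag (fun=> 1)) *m U^t*.
    by rewrite mulmxDr mulmxDl rdiag1 mulmx1 UU -XE subrK.
  rewrite adjM rdiag_adj mulmxA -[in RHS](mulmxA U) rdiagM rdiagD.
  have -> : (fun i => r i * r i) = (fun i => x i + 1); last exact: erefl.
  by apply/funext => i; rewrite rr addrC.
- rewrite adjM rdiag_adj adjK mulmxA -(mulmxA (rdiag _)) UU' mulmx1 rdiagM.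
  rewrite retr_rdiag -[n in n%:R]card_ord -sumr_const; apply: ler_sum => i _.
  by rewrite -invfM invf_le1 // rr ?lerDl // ltr_pwDl.
Qed.

(** Simultaneous diagonalization by congruence: after factoring [X] by [S], a unitary [V]
    diagonalizes [Si *m Y *m Si^t*], and [B] is [S *m V]. The [d i] are the eigenvalues of [Y]
    relative to [X]. *)
Lemma pencil_rdiag n (X Y : 'M[C]_n) : psdmx (X - 1%:M) -> psdmx (Y - 1%:M) ->
  exists B Bi (d : 'I_n -> R), [/\ B *m Bi = 1%:M, Bi *m B = 1%:M,
    X = B *m B^t*, Y = B *m rdiag d *m B^t* &
    (forall i, 0 < d i) /\ retr (Bi *m Bi^t*) <= n%:R].
Proof.
move=> pX pY; have [S [Si [SSi XS tS]]] := pd_factor pX.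
have hY : Y^t* = Y by rewrite -[Y](subrK 1%:M) adjD adj1 (psdmx_adj pY).
have hZ : (Si *m Y *m Si^t*)^t* = Si *m Y *m Si^t*.
  by rewrite adjM adjK adjM hY mulmxA.
have [V [d [VV VV' ZE]]] := herm_rdiag hZ.
have BBi : S *m V *m (V^t* *m Si) = 1%:M.
  by rewrite mulmxA -(mulmxA S) VV mulmx1.
have BiB := mulmx1C BBi.
have YB : Y = S *m V *m rdiag d *m (S *m V)^t*.
  rewrite adjM mulmxA -(mulmxA S) -(mulmxA S) -ZE !mulmxA SSi mul1mx -mulmxA.
  by rewrite -adjM SSi adj1 mulmx1.
have XB : X = S *m V *m (S *m V)^t*.
  by rewrite adjM mulmxA -(mulmxA S) VV mulmx1.
have tB : retr (V^t* *m Si *m (V^t* *m Si)^t*) <= n%:R.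
  by rewrite adjM adjK retr_mulC !mulmxA -(mulmxA _ V) VV mulmx1 retr_mulC.
move: (S *m V) (V^t* *m Si) BBi BiB YB XB tB => B Bi BBi BiB YB XB tB.
exists B, Bi, d; split; [exact: BBi | exact: BiB | exact: XB | exact: YB |].
split; last exact: tB.
(* As [Y] dominates the identity, [d i] is at least the squared norm of row [i] of [Bi], which is
   nonzero since [Bi] is invertible. *)
move=> i; have dE : rdiag d = Bi *m Y *m Bi^t*.
  by rewrite YB !mulmxA BiB mul1mx -mulmxA -adjM BiB adj1 mulmx1.
have := psdmx_diag i (psdmx_conj Bi pY).
rewrite mulmxBr mulmx1 mulmxBl -dE mxE [in X in _ + X]mxE rdiagE eqxx.
have -> : (Bi *m Bi^t*) i i = (\sum_k nc (Bi i k) ^+ 2)%:C.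
  by rewrite mxE rmorph_sum; apply: eq_bigr => k _; rewrite !mxE mulJ_nc.
rewrite -rmorphN -rmorphD lecR subr_ge0 mulr1n; apply: lt_le_trans.
rewrite lt_neqAle sumr_ge0 ?andbT => [|k _]; last exact: sqr_ge0.
apply/negP => /eqP/esym/eqP; rewrite psumr_eq0 => [|k _]; last exact: sqr_ge0.
move=> /allP h; have /matrixP/(_ i i)/eqP := BiB; rewrite !mxE eqxx big1.
  by rewrite eq_sym oner_eq0.
move=> k _; have := h k (mem_index_enum _); rewrite /= sqrf_eq0 => /eqP/nc_eq0.
by move=> ->; rewrite mul0r.
Qed.
End PositiveSemidefinite.

(** * The logarithm of the determinant and its strong concavity *)

HB.lock Definition ld (R : realType) n (X : 'M[R[i]]_n) : R :=
  ln (complex.Re (\det X)).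

Section LogDet.
Variable R : realType.
Local Notation C := R[i].

Lemma ln_le_sub1 (x : R) : 0 < x -> ln x <= x - 1.
Proof.
by move=> x0; have := @le_ln1Dx R (x - 1); rewrite [1 + _]addrC subrK; apply; lra.
Qed.

(* With [r = sqrt d], [ln d = 2 ln r <= 2 (r - 1) = (d - 1) - (r - 1) ^ 2]. *)
Lemma ln_le_quad (d D : R) : 0 < d -> d <= D ->
  ln d <= (d - 1) - (d - 1) ^+ 2 / (D + 2) ^+ 2.
Proof.
move=> d0 dD; pose r := Num.sqrt d.
have r0 : 0 < r by rewrite sqrtr_gt0.
have rE : d = r ^+ 2 by rewrite sqr_sqrtr // ltW.
have rD : r <= 1 + D by apply: ler_sqr1; rewrite -rE.
have D0 : 0 < D by apply: lt_le_trans dD.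
have lnE : ln d = 2 * ln r.
  by rewrite rE expr2 lnM ?posrE // mulr_natl mulr2n.
have h : (d - 1) ^+ 2 / (D + 2) ^+ 2 <= (r - 1) ^+ 2.
  rewrite ler_pdivrMr ?exprn_gt0 ?addr_gt0 // -exprMn rE.
  have -> : r ^+ 2 - 1 = (r - 1) * (r + 1) by ring.
  rewrite !exprMn ler_wpM2l ?sqr_ge0 // lerXn2r ?nnegrE //; lra.
have dE : d - 1 = 2 * (r - 1) + (r - 1) ^+ 2 by rewrite rE; ring.
rewrite lnE [X in X - _]dE; have := ln_le_sub1 r0; lra.
Qed.

Lemma ln_prod (I : Type) (s : seq I) (F : I -> R) : (forall i, 0 < F i) ->
  ln (\prod_(i <- s) F i) = \sum_(i <- s) ln (F i).
Proof.
move=> F0; elim: s => [|i s IHs]; first by rewrite !big_nil ln1.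
by rewrite !big_cons lnM ?posrE ?prodr_gt0 // IHs.
Qed.

Lemma sqr_sum_le n (e : 'I_n -> R) :
  (\sum_i `|e i|) ^+ 2 <= n%:R * \sum_i e i ^+ 2.
Proof.
rewrite expr2 mulr_suml.
rewrite (@le_trans _ _ (\sum_i \sum_j (e i ^+ 2 / 2 + e j ^+ 2 / 2))) //.
  apply: ler_sum => i _; rewrite mulr_sumr; apply: ler_sum => j _.
  have := sqr_ge0 (`|e i| - `|e j|).
  by rewrite sqrrB !real_normK ?num_real //; lra.
under eq_bigr do rewrite big_split /= sumr_const card_ord.
rewrite big_split /= sumr_const card_ord sumrMnl -mulr_suml.
rewrite -mulr_natl; set S := \sum_i _; lra.
Qed.

Lemma det_gram n (B : 'M[C]_n) : \det (B *m B^t*) = (nc (\det B) ^+ 2)%:C.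
Proof. by rewrite det_mulmx det_map_mx det_tr mulJ_nc. Qed.

Lemma nc_det_gt0 n (B Bi : 'M[C]_n) : B *m Bi = 1%:M -> 0 < nc (\det B).
Proof.
move=> /mulmx1_unit[]; rewrite unitmxE unitfE => h _.
rewrite lt_neqAle nc_ge0 andbT eq_sym; apply: contra h => /eqP /nc_eq0 ->.
exact: eqxx.
Qed.

Lemma inv_pencil n (B Bi : 'M[C]_n) : B *m Bi = 1%:M ->
  B *m B^t* \in unitmx /\ invmx (B *m B^t*) = Bi^t* *m Bi.
Proof.
move=> BBi; have BiB := mulmx1C BBi.
have h : Bi^t* *m Bi *m (B *m B^t*) = 1%:M.
  by rewrite mulmxA -(mulmxA _ Bi) BiB mulmx1 -adjM BBi adj1.
have [_ u] := mulmx1_unit h; split=> //.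
by rewrite -[RHS]mulmx1 -(mulmxV u) mulmxA h mul1mx.
Qed.

Lemma pd_inv n (X : 'M[C]_n) : psdmx (X - 1%:M) ->
  [/\ X \in unitmx, psdmx (invmx X), l1 (invmx X) <= n%:R ^+ 3 &
      0 < complex.Re (\det X)].
Proof.
move=> pX; have [B [Bi [d [BBi BiB XE _ [_ tB]]]]] := pencil_rdiag pX pX.
have [u iE] := inv_pencil BBi; rewrite -XE in u iE.
have pi : psdmx (invmx X) by rewrite iE -{2}(adjK Bi); exact: psdmx_gram.
split=> //.
  rewrite (le_trans (l1_psd_le pi)) // exprS expr2 mulrA ler_wpM2l ?mulr_ge0 //.
  by rewrite iE retr_mulC.
by rewrite XE det_gram exprn_gt0 // (nc_det_gt0 BBi).
Qed.

(** In the coordinates of the pencil, the increment of [ld] is the sum of the [ln (d i)] and the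
    linear term is the sum of the [d i - 1], so the claim reduces to [ln_le_quad]. The bound [beta]
    on the traces is what makes [c] uniform. *)
Lemma ld_concave n (beta : R) : exists2 c, 0 < c &
  forall X Y : 'M[C]_n, psdmx (X - 1%:M) -> psdmx (Y - 1%:M) ->
    retr X <= beta -> retr Y <= beta ->
    ld Y <= ld X + retr (invmx X *m (Y - X)) - c * l1 (Y - X) ^+ 2.
Proof.
(* [b1] bounds [l1 B], [b2] bounds [l1 Bi] and [D] bounds the [d i]; [k] converts the sum of the
   squares of [d i - 1] into the square of [l1 (Y - X)]. *)
pose b1 : R := n%:R * n%:R * (1 + `|beta|).
pose b2 : R := n%:R * n%:R * (1 + n%:R).
pose D : R := b2 * (n%:R * n%:R * `|beta|) * b2.
have b10 : 0 <= b1 by rewrite !mulr_ge0 // addr_ge0.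
have b20 : 0 <= b2 by rewrite !mulr_ge0 // addr_ge0.
have D0 : 0 <= D by rewrite !mulr_ge0.
pose k : R := (b1 * b1) ^+ 2 * n%:R + 1.
have k0 : 0 < k by rewrite ltr_pwDr // mulr_ge0 // exprn_ge0 // mulr_ge0.
have D20 : 0 < (D + 2) ^+ 2 by rewrite exprn_gt0 // ltr_pwDr.
exists (((D + 2) ^+ 2 * k)^-1); first by rewrite invr_gt0 mulr_gt0.
move=> X Y pX pY tX tY.
have [B [Bi [d [BBi BiB XE YE [d0 tB]]]]] := pencil_rdiag pX pY.
have [uX iX] := inv_pencil BBi; rewrite -XE in uX iX.
have dE : rdiag d = Bi *m Y *m Bi^t*.
  by rewrite YE !mulmxA BiB mul1mx -mulmxA -adjM BiB adj1 mulmx1.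
have pY' : psdmx Y by rewrite -(subrK 1%:M Y); exact/psdmxD/psdmx1.
have lBi : l1 Bi <= b2.
  by rewrite (le_trans (l1_le_gram _)) // ler_wpM2l ?mulr_ge0 // lerD2l.
have lB : l1 B <= b1.
  rewrite (le_trans (l1_le_gram _)) // ler_wpM2l ?mulr_ge0 // lerD2l -XE.
  by rewrite (le_trans tX) // ler_norm.
have lY : l1 Y <= n%:R * n%:R * `|beta|.
  rewrite (le_trans (l1_psd_le pY')) // ler_wpM2l ?mulr_ge0 //.
  by rewrite (le_trans tY) // ler_norm.
have dD i : d i <= D.
  have -> : d i = complex.Re (rdiag d i i) by rewrite rdiagE eqxx.
  rewrite (le_trans (ler_norm _)) // (le_trans (ler_Re_nc _)) //.
  rewrite (le_trans (l1_entry _ _ _)) // dE (le_trans (l1M _ _)) //.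
  rewrite l1_adj ler_pM ?l1_ge0 // (le_trans (l1M _ _)) //.
  by rewrite ler_pM ?l1_ge0.
have YX : Y - X = B *m rdiag (fun i => d i - 1) *m B^t*.
  by rewrite -rdiagB rdiag1 mulmxBr mulmxBl mulmx1 -XE -YE.
have tE : retr (invmx X *m (Y - X)) = \sum_i (d i - 1).
  rewrite YX iX retr_mulC !mulmxA retr_mulC !mulmxA BiB mul1mx -mulmxA -adjM BiB adj1.
  by rewrite mulmx1 retr_rdiag.
have ldY : ld Y = ld X + \sum_i ln (d i).
  rewrite ld.unlock YE XE !det_mulmx det_rdiag mulrAC -det_mulmx det_gram -rmorphM /=.
  by rewrite lnM ?posrE ?exprn_gt0 ?(nc_det_gt0 BBi) ?prodr_gt0 // ln_prod.
have lYX : l1 (Y - X) ^+ 2 <= k * \sum_i (d i - 1) ^+ 2.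
  rewrite (@le_trans _ _ ((b1 * b1) ^+ 2 * (\sum_i `|d i - 1|) ^+ 2)) //.
    rewrite -exprMn lerXn2r ?nnegrE ?l1_ge0 ?mulr_ge0 ?sumr_ge0 //.
    rewrite YX (le_trans (l1M _ _)) // l1_adj mulrAC ler_pM ?l1_ge0 //.
    by rewrite (le_trans (l1M _ _)) // l1_rdiag ler_wpM2r ?sumr_ge0.
  rewrite (@le_trans _ _ ((b1 * b1) ^+ 2 * n%:R * \sum_i (d i - 1) ^+ 2)) //.
    by rewrite -mulrA ler_wpM2l ?sqr_sum_le // exprn_ge0 // mulr_ge0.
  by rewrite ler_wpM2r ?lerDl // sumr_ge0 // => i _; exact: sqr_ge0.
rewrite ldY tE -addrA lerD2l.
rewrite (@le_trans _ _ (\sum_i ((d i - 1) - (d i - 1) ^+ 2 / (D + 2) ^+ 2))) //.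
  by apply: ler_sum => i _; exact: ln_le_quad.
rewrite big_split /= lerD2l sumrN lerN2 -mulr_suml invfM -mulrA mulrC.
rewrite ler_wpM2r ?invr_ge0 ?(ltW D20) // mulrC ler_pdivrMr // mulrC.
exact: lYX.
Qed.

Lemma ld_tangent n (X Y : 'M[C]_n) : psdmx (X - 1%:M) -> psdmx (Y - 1%:M) ->
  ld Y <= ld X + retr (invmx X *m (Y - X)).
Proof.
move=> pX pY; have [c c0 h] := ld_concave n (Num.max (retr X) (retr Y)).
rewrite (le_trans (h X Y pX pY _ _)) ?le_max ?lexx ?orbT //.
by rewrite lerBlDr lerDl mulr_ge0 ?(ltW c0) // exprn_ge0 // l1_ge0.
Qed.

Lemma ld1 n : ld (1%:M : 'M[C]_n) = 0.
Proof. by rewrite ld.unlock det1 ln1. Qed.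

Lemma invmxB n (X Y : 'M[C]_n) : X \in unitmx -> Y \in unitmx ->
  invmx X - invmx Y = invmx X *m (Y - X) *m invmx Y.
Proof.
by move=> uX uY; rewrite mulmxBr mulVmx // mulmxBl mul1mx -mulmxA mulmxV // mulmx1.
Qed.

Lemma l1_invB n (X Y : 'M[C]_n) : psdmx (X - 1%:M) -> psdmx (Y - 1%:M) ->
  l1 (invmx X - invmx Y) <= n%:R ^+ 6 * l1 (X - Y).
Proof.
move=> /pd_inv [uX _ lX _] /pd_inv [uY _ lY _]; rewrite invmxB // l1B -/(l1 _).
rewrite (le_trans (l1M _ _)) // (@le_trans _ _ (n%:R ^+ 3 * l1 (Y - X) * n%:R ^+ 3)) //.
  rewrite ler_pM ?l1_ge0 // (le_trans (l1M _ _)) // ler_wpM2r ?l1_ge0 //.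
by rewrite mulrAC -exprD l1B.
Qed.

(** Strong concavity is applied from [X] to the identity, where [ld] vanishes: the linear term has
    the favourable sign, and the quadratic term is strictly positive. *)
Lemma ld_gt0 n (X : 'M[C]_n) : psdmx (X - 1%:M) -> X != 1%:M -> 0 < ld X.
Proof.
move=> pX XN1; have [c c0 h] := ld_concave n (Num.max (retr X) n%:R).
have p1 : psdmx ((1%:M : 'M[C]_n) - 1%:M) by rewrite subrr; exact: psdmx0.
have := h X 1%:M pX p1; rewrite retr1 !le_max !lexx orbT ld1 => /(_ isT isT).
have l0 : 0 < l1 (1%:M - X).
  rewrite lt_neqAle l1_ge0 andbT eq_sym; apply: contra XN1 => /eqP/l1_eq0/eqP.
  by rewrite subr_eq0 eq_sym.
have : 0 <= retr (invmx X *m (X - 1%:M)).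
  have [_ pi _ _] := pd_inv pX; have [B ->] := psdmx_factor pX.
  rewrite mulmxA retr_mulC mulmxA -{2}(adjK B).
  by apply: retr_psd_ge0; rewrite adjK; have := psdmx_conj (B^t*) pi; rewrite adjK.
rewrite -[1%:M - X]opprB mulmxN retrN l1N.
have : 0 < c * l1 (X - 1%:M) ^+ 2 by rewrite mulr_gt0 // exprn_gt0 // l1B.
lra.
Qed.
End LogDet.

Lemma le0_small (R : realFieldType) (x k : R) : 0 <= k ->
  (forall t, 0 < t <= 1 -> x <= k * t) -> x <= 0.
Proof.
move=> k0 h; rewrite leNgt; apply/negP => x0.
pose t := Num.min 1 (x / (2 * (k + 1))).
have k10 : 0 < 2 * (k + 1) by rewrite mulr_gt0 // ltr_pwDr.
have t0 : 0 < t by rewrite lt_min ltr01 divr_gt0.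
have t1 : t <= 1 by rewrite ge_min lexx.
have := h t; rewrite t0 t1 => /(_ isT) xkt.
have : t <= x / (2 * (k + 1)) by rewrite ge_min lexx orbT.
rewrite ler_pdivlMr // => ht; nra.
Qed.

(** This is the tangent at [eps^-1] times the identity, where the gradient is [eps] times the
    identity. It expresses that [ld] grows more slowly than any linear function of the trace. *)
Lemma ld_le_affine (R : realType) n (eps : R) : 0 < eps <= 1 -> exists C,
  forall X : 'M[R[i]]_n, psdmx (X - 1%:M) -> ld X <= C + eps * retr X.
Proof.
move=> /andP[e0 e1]; pose Z : 'M[R[i]]_n := (eps^-1)%:C%:M.
have pZ : psdmx (Z - 1%:M).
  have -> : Z - 1%:M = (eps^-1 - 1)%:C *: 1%:M.
    by rewrite rmorphB scalerBl scalemx1 scale1r.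
  by apply: psdmxZ; [rewrite subr_ge0 invf_ge1 | exact: psdmx1].
have iZ : invmx Z = eps%:C%:M by rewrite /Z invmx_scalar fmorphV invrK.
exists (ld Z - eps * retr Z) => X pX.
have := ld_tangent pZ pX; rewrite iZ mul_scalar_mx retrZ retrB; lra.
Qed.

(** * The objective, its Dinkelbach surrogate, and the bounds on steps and gaps *)

HB.lock Definition covH (R : realType) (M N K : nat)
    (H : 'I_K -> 'M[R[i]]_(N, M)) i (V : 'M[R[i]]_N) : 'M[R[i]]_M :=
  (H i)^t* *m V *m H i.
HB.lock Definition cov (R : realType) (M N K : nat)
    (H : 'I_K -> 'M[R[i]]_(N, M)) (s : R) (Q : 'I_K -> 'M[R[i]]_N) : 'M[R[i]]_M :=
  1%:M + s%:C *: \sum_i covH H i (Q i).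

Section Objective.
Variables (R : realType) (M N K : nat) (H : 'I_K -> 'M[R[i]]_(N, M)).
Variables (a s e c0 : R).
Hypotheses (a0 : 0 < a) (s0 : 0 < s) (e0 : 0 < e) (c00 : 0 < c0).
Local Notation tuple := ('I_K -> 'M[R[i]]_N).
Implicit Types Q : tuple.

Local Notation covH := (covH H).
Local Notation cov := (cov H s).
Definition trsum Q : R := \sum_i retr (Q i).
Definition pow Q : R := e * trsum Q + c0.
(** The energy efficiency with [a = W / ln 2], [s = sigma2^-1], [e = eta^-1] and
    [c0 = M%:R * Pdyn + Psta]. *)
Definition ee Q : R := a * ld (cov Q) / pow Q.
Definition pos Q := forall i, psdmx (Q i).
Definition upd Q i V : tuple := fun j => if j == i then V else Q j.

(* The derivative at covariance [X] and in the direction [V] of block [i] of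
   [a * ld (cov Q) - lambda * pow Q], the Dinkelbach surrogate of [ee]. *)
Definition grad (X : 'M[R[i]]_M) i (V : 'M[R[i]]_N) (lambda : R) : R :=
  a * s * retr (invmx X *m covH i V) - lambda * e * retr V.

Lemma covHB i V V' : covH i (V - V') = covH i V - covH i V'.
Proof. by rewrite covH.unlock mulmxBr mulmxBl. Qed.

Lemma covHZ i (x : R) V : covH i (x%:C *: V) = x%:C *: covH i V.
Proof. by rewrite covH.unlock -scalemxAr -scalemxAl. Qed.

Lemma covH0 i : covH i 0 = 0.
Proof. by rewrite covH.unlock mulmx0 mul0mx. Qed.

Lemma psdmx_covH i V : psdmx V -> psdmx (covH i V).
Proof. by move=> pV; have := psdmx_conj ((H i)^t*) pV; rewrite adjK covH.unlock. Qed.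

Lemma psdmx_cov Q : pos Q -> psdmx (cov Q - 1%:M).
Proof.
move=> pQ; rewrite cov.unlock addrC addKr; apply: psdmxZ; first exact: ltW.
by apply: psdmx_sum => i; exact: psdmx_covH.
Qed.

Lemma covB Q Q' : cov Q' - cov Q = s%:C *: \sum_i covH i (Q' i - Q i).
Proof.
rewrite cov.unlock opprD addrACA subrr add0r -scalerBr -sumrB.
by congr (_ *: _); apply: eq_bigr => i _; rewrite covHB.
Qed.

Lemma trsum_ge0 Q : pos Q -> 0 <= trsum Q.
Proof. by move=> pQ; apply: sumr_ge0 => i _; exact: retr_psd_ge0. Qed.

Lemma pow_gt0 Q : pos Q -> 0 < pow Q.
Proof. by move=> /trsum_ge0 h; rewrite ltr_wpDl // mulr_ge0 // ltW. Qed.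

Lemma ee_pow Q : pos Q -> a * ld (cov Q) = ee Q * pow Q.
Proof. by move=> /pow_gt0 h; rewrite /ee divfK // gt_eqF. Qed.

Lemma pos_upd Q i V : pos Q -> psdmx V -> pos (upd Q i V).
Proof. by move=> pQ pV j; rewrite /upd; case: eqP => _; [exact: pV | exact: pQ]. Qed.

Lemma upd_id Q i : upd Q i (Q i) = Q.
Proof. by apply/funext => j; rewrite /upd; case: eqP => // ->. Qed.

Lemma sum_upd (W : zmodType) Q i V (F : 'I_K -> 'M[R[i]]_N -> W) :
  \sum_j F j (upd Q i V j) = \sum_j F j (Q j) + (F i V - F i (Q i)).
Proof.
rewrite (bigD1 i) //= [in RHS](bigD1 i) //= /upd eqxx [RHS]addrC addrA subrK.
congr (_ + _).
by apply: eq_bigr => j /negbTE ->.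
Qed.

Lemma cov_upd Q i V : cov (upd Q i V) = cov Q + s%:C *: covH i (V - Q i).
Proof. by rewrite cov.unlock (sum_upd Q i V covH) scalerDr addrA covHB. Qed.

Lemma pow_upd Q i V : pow (upd Q i V) = pow Q + e * retr (V - Q i).
Proof.
by rewrite /pow /trsum (sum_upd Q i V (fun=> @retr R N)) retrB mulrDr addrAC.
Qed.

(** Bounded power keeps the received covariance in a range where [ld_concave] has a uniform
    constant; the affine form also serves coercivity. *)
Lemma retr_covH_le : exists2 h, 0 <= h &
  forall Q, pos Q -> retr (cov Q) <= M%:R + h * trsum Q.
Proof.
pose h i : R := l1 (H i) * (N%:R * N%:R) * l1 (H i).
have h0 i : 0 <= h i by rewrite !mulr_ge0 ?l1_ge0.
exists (s * \sum_i h i); first by rewrite mulr_ge0 ?(ltW s0) // sumr_ge0.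
move=> Q pQ; rewrite cov.unlock retrD retr1 retrZ lerD2l -mulrA ler_pM2l //.
rewrite retr_sum /trsum mulr_sumr; apply: ler_sum => i _.
rewrite (le_trans (ler_norm _)) // (le_trans (retr_le _)) //.
rewrite covH.unlock (le_trans (l1M _ _)) // (@le_trans _ _ (h i * retr (Q i))) //.
  rewrite /h mulrAC ler_wpM2r ?l1_ge0 // (le_trans (l1M _ _)) // l1_adj -mulrA.
  by rewrite ler_wpM2l ?l1_ge0 // l1_psd_le.
rewrite ler_wpM2r ?retr_psd_ge0 // (bigD1 i) //= lerDl.
by apply: sumr_ge0.
Qed.

(** The numerator grows sublinearly in the power and the denominator linearly, so a positive value
    excludes large powers. *)
Lemma ee_coercive (l : R) : 0 < l -> exists beta, forall Q, pos Q ->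
  l <= ee Q -> trsum Q <= beta.
Proof.
move=> l0; have [h h0 hh] := retr_covH_le.
(* This makes the slope [a * eps * h] of the bound on the numerator at most half of the slope
   [l * e] of [l * pow Q]. *)
pose eps := Num.min 1 (l * e / (2 * (a * h + 1))).
have k0 : 0 < 2 * (a * h + 1) by rewrite mulr_gt0 // ltr_pwDr // mulr_ge0 // ltW.
have eps0 : 0 < eps by rewrite lt_min ltr01 divr_gt0 // mulr_gt0.
have eps1 : eps <= 1 by rewrite ge_min lexx.
have epsh : a * (eps * h) <= l * e / 2.
  have : eps <= l * e / (2 * (a * h + 1)) by rewrite ge_min lexx orbT.
  rewrite ler_pdivlMr // => h1; rewrite mulrCA.
  have := ltW eps0; have := mulr_ge0 (ltW a0) h0; nra.
have e01 : 0 < eps <= 1 by rewrite eps0.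
have [C hC] := ld_le_affine M e01.
exists (a * (C + eps * M%:R) * 2 / (l * e)) => Q pQ lQ.
have le0 : 0 < l * e by rewrite mulr_gt0.
rewrite ler_pdivlMr //.
have h1 : l * pow Q <= a * ld (cov Q).
  by rewrite ee_pow // ler_pM2r // pow_gt0.
have h2 : a * ld (cov Q) <= a * (C + eps * (M%:R + h * trsum Q)).
  rewrite ler_pM2l // (le_trans (hC _ (psdmx_cov pQ))) // lerD2l ler_pM2l //.
  exact: hh.
have h3 := ler_wpM2r (trsum_ge0 pQ) epsh.
have h4 : l * (e * trsum Q) <= l * pow Q by rewrite ler_pM2l // lerDl ltW.
nra.
Qed.

(** [pow] is affine, so the quadratic term of [ld] survives, with a constant that does not depend on
    [lambda]. *)
Lemma surrogate_concave (beta : R) : exists2 c, 0 < c &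
  forall Q Q' lambda, pos Q -> pos Q' -> trsum Q <= beta -> trsum Q' <= beta ->
    a * ld (cov Q') - lambda * pow Q' <=
    a * ld (cov Q) - lambda * pow Q +
    \sum_i grad (cov Q) i (Q' i - Q i) lambda - c * l1 (cov Q' - cov Q) ^+ 2.
Proof.
have [h h0 hh] := retr_covH_le.
have [c c0' hc] := ld_concave M (M%:R + h * beta).
exists (a * c); first exact: mulr_gt0.
move=> Q Q' lambda pQ pQ' tQ tQ'.
have hX Q1 : pos Q1 -> trsum Q1 <= beta -> retr (cov Q1) <= M%:R + h * beta.
  by move=> p1 t1; rewrite (le_trans (hh _ p1)) // lerD2l ler_wpM2l.
have := hc _ _ (psdmx_cov pQ) (psdmx_cov pQ') (hX _ pQ tQ) (hX _ pQ' tQ').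
have -> : \sum_i grad (cov Q) i (Q' i - Q i) lambda =
    a * retr (invmx (cov Q) *m (cov Q' - cov Q)) - lambda * (pow Q' - pow Q).
  rewrite /grad big_split /= sumrN -!mulr_sumr; congr (_ - _).
    rewrite covB -scalemxAr retrZ mulrA mulmx_sumr retr_sum //.
  have -> : \sum_i retr (Q' i - Q i) = trsum Q' - trsum Q.
    by rewrite /trsum -sumrB; apply: eq_bigr => i _; rewrite retrB.
  by rewrite /pow; ring.
move: (l1 _ ^+ 2).
move: (ld (cov Q')) (ld (cov Q)) => u v; move: (retr _) (pow Q') (pow Q).
by move=> w p' p q hld; have := ler_wpM2l (ltW a0) hld; lra.
Qed.

(* The tangent at the moved point is used instead of an expansion of [ld] at
   the maximizer, so that only concavity and the continuity of the inverse
   are needed. *)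
Lemma first_order Q i : pos Q ->
  (forall V, psdmx V -> ee (upd Q i V) <= ee Q) ->
  forall V, psdmx V -> grad (cov Q) i (V - Q i) (ee Q) <= 0.
Proof.
move=> pQ hmax V pV; pose D := V - Q i; pose G := s%:C *: covH i D.
have k0 : 0 <= a * (M%:R ^+ 6 * l1 G * l1 G).
  by rewrite mulr_ge0 ?(ltW a0) // !mulr_ge0 ?l1_ge0 // exprn_ge0.
apply: (le0_small k0) => t /andP[t0 t1].
pose Vt := Q i + t%:C *: D.
have pVt : psdmx Vt.
  have -> : Vt = (1 - t)%:C *: Q i + t%:C *: V.
    rewrite /Vt /D scalerBr rmorphB rmorph1 scalerBl scale1r.
    by rewrite addrA addrAC.
  apply: psdmxD; apply: psdmxZ; [by rewrite subr_ge0 | exact: pQ | exact: ltW |].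
  exact: pV.
have pQt := pos_upd i pQ pVt.
have VtE : Vt - Q i = t%:C *: D by rewrite /Vt addrC addKr.
have XtE : cov (upd Q i Vt) = cov Q + t%:C *: G.
  by rewrite cov_upd VtE covHZ /G !scalerA mulrC.
have PtE : pow (upd Q i Vt) = pow Q + e * (t * retr D).
  by rewrite pow_upd VtE retrZ.
set Xt := cov (upd Q i Vt) in XtE.
have pXt : psdmx (Xt - 1%:M) by exact: psdmx_cov.
have h1 : a * ld Xt <= ee Q * (pow Q + e * (t * retr D)).
  by rewrite -PtE ee_pow // ler_pM2r ?pow_gt0 // hmax.
have h2 : ld (cov Q) <= ld Xt - t * retr (invmx Xt *m G).
  have := ld_tangent pXt (psdmx_cov pQ).
  have -> : cov Q - Xt = - (t%:C *: G) by rewrite XtE opprD addrA subrr sub0r.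
  by rewrite mulmxN retrN -scalemxAr retrZ.
have h3 : retr (invmx (cov Q) *m G) <=
    retr (invmx Xt *m G) + M%:R ^+ 6 * l1 G * l1 G * t.
  rewrite -lerBlDl -retrB -mulmxBl (le_trans (ler_norm _)) //.
  rewrite (le_trans (retr_le _)) // (le_trans (l1M _ _)) // mulrAC.
  rewrite ler_wpM2r ?l1_ge0 // (le_trans (l1_invB (psdmx_cov pQ) pXt)) //.
  rewrite -[leRHS]mulrA ler_wpM2l ?exprn_ge0 // XtE opprD addrA subrr sub0r l1N l1Z gtr0_norm //.
  by rewrite mulrC.
have h4 : a * retr (invmx Xt *m G) <= ee Q * e * retr D.
  rewrite -(ler_pM2l t0); move: h1 h2 (ee_pow pQ) => {h3}.
  move: (ld Xt) (ld (cov Q)) (retr _) (retr D) (ee Q) (pow Q).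
  move=> u v w w' l p h1 h2 h3; have := ler_wpM2l (ltW a0) h2; lra.
have -> : grad (cov Q) i (V - Q i) (ee Q) =
    a * retr (invmx (cov Q) *m G) - ee Q * e * retr D.
  by rewrite /grad -/D /G -scalemxAr retrZ mulrA.
move: h3 h4; move: (retr (_ *m G)) (retr (_ *m G)) (retr D) (ee Q) (l1 G).
by move=> u v w l z h3 h4; have := ler_wpM2l (ltW a0) h3; lra.
Qed.

(** For [lambda = ee Q'] the surrogate is 0 at [Q'] and [- (ee Q' - ee Q) * pow Q] at [Q]. Expanding
    at the optimal point [Q'], the gradient in block [i] is nonpositive and the other blocks do not
    move, so the quadratic term is at most the gain times [pow Q]. *)
Lemma step_increase (beta : R) : exists2 C, 0 <= C & forall Q Q' i,
  pos Q -> pos Q' -> trsum Q <= beta -> trsum Q' <= beta ->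
  (forall j, j != i -> Q' j = Q j) ->
  (forall V, psdmx V -> ee (upd Q' i V) <= ee Q') ->
  l1 (cov Q' - cov Q) ^+ 2 <= C * (ee Q' - ee Q).
Proof.
have [c c0' hc] := surrogate_concave beta.
have b0 : 0 <= (e * `|beta| + c0) / c.
  by rewrite divr_ge0 ?(ltW c0') // addr_ge0 ?(ltW c00) // mulr_ge0 // ltW.
exists ((e * `|beta| + c0) / c) => // Q Q' i pQ pQ' tQ tQ' hj hmax.
have QE : upd Q' i (Q i) = Q.
  apply/funext => j; rewrite /upd; have [->|/hj] // := eqVneq j i.
have gQ : ee Q <= ee Q' by rewrite -[in X in X <= _]QE hmax.
have := hc Q' Q (ee Q') pQ' pQ tQ' tQ.
rewrite (ee_pow pQ) (ee_pow pQ') subrr add0r (bigD1 i) //= big1 ?addr0.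
  have := first_order pQ' hmax (pQ i).
  move=> h1 h2; rewrite l1B [leRHS]mulrAC ler_pdivlMr // [_ * c]mulrC.
  move: h1 h2.
  have : pow Q <= e * `|beta| + c0.
    by rewrite lerD2r ler_pM2l // (le_trans tQ) // ler_norm.
  move: gQ; move: (ee Q) (ee Q') (pow Q) (grad _ _ _ _) (l1 _ ^+ 2).
  move=> g g' p r q gg' hp r0 h.
  by rewrite -subr_ge0 in gg'; have := ler_wpM2r gg' hp; lra.
by move=> j /hj ->; rewrite subrr /grad covH0 mulmx0 !retr0 !mulr0 subrr.
Qed.

Lemma ld_lipschitz (X Y : 'M[R[i]]_M) :
  psdmx (X - 1%:M) -> psdmx (Y - 1%:M) ->
  `|ld X - ld Y| <= M%:R ^+ 3 * l1 (X - Y).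
Proof.
have half (X1 X2 : 'M[R[i]]_M) : psdmx (X1 - 1%:M) -> psdmx (X2 - 1%:M) ->
    ld X1 - ld X2 <= M%:R ^+ 3 * l1 (X1 - X2).
  move=> p1 p2; rewrite lerBlDl (le_trans (ld_tangent p2 p1)) // lerD2l.
  rewrite (le_trans (ler_norm _)) // (le_trans (retr_le _)) //.
  rewrite (le_trans (l1M _ _)) // ler_wpM2r ?l1_ge0 //.
  by have [] := pd_inv p2.
move=> pX pY; rewrite ler_norml half // andbT lerNl opprB l1B.
exact: half.
Qed.

Lemma ee_ge0 Q : pos Q -> 0 <= ee Q.
Proof.
move=> pQ; rewrite /ee mulr_ge0 ?invr_ge0 ?(ltW (pow_gt0 pQ)) // mulr_ge0 ?(ltW a0) //.
have [->|/(ld_gt0 (psdmx_cov pQ))/ltW //] := eqVneq (cov Q) 1%:M.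
by rewrite ld1.
Qed.

(** The covariance is bounded as for a block step, with all blocks optimal at [Qs]. The power has no
    quadratic term of its own: it is recovered from the covariance and the value, which requires
    dividing by [ee Qs]. *)
Lemma gap_bound (Qs : tuple) (beta : R) : pos Qs -> trsum Qs <= beta ->
  0 < ee Qs -> (forall Q, pos Q -> ee Q <= ee Qs) ->
  exists2 C, 0 <= C & forall Q, pos Q -> trsum Q <= beta ->
    l1 (cov Q - cov Qs) ^+ 2 + (pow Q - pow Qs) ^+ 2 <= C * (ee Qs - ee Q).
Proof.
move=> pQs tQs ls0 hmax.
have [c c0' hc] := surrogate_concave beta.
have b0 : 0 <= beta by rewrite (le_trans _ tQs) // trsum_ge0.
pose Pb := e * beta + c0.
have Pb0 : 0 < Pb by rewrite ltr_wpDl // mulr_ge0 // ltW.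
pose ls := ee Qs.
pose k := a * M%:R ^+ 3.
have k0 : 0 <= k by rewrite mulr_ge0 ?(ltW a0) // exprn_ge0.
pose C2 := 2 * (k ^+ 2 * (Pb / c) + Pb ^+ 2 * ls) / ls ^+ 2.
have C20 : 0 <= C2.
  rewrite divr_ge0 ?exprn_ge0 ?(ltW ls0) // mulr_ge0 // addr_ge0 // mulr_ge0 //.
  - exact: sqr_ge0.
  - by rewrite divr_ge0 // ltW.
  - exact: sqr_ge0.
  - exact: ltW.
exists (Pb / c + C2); first by rewrite addr_ge0 // divr_ge0 // ltW.
move=> Q pQ tQ; pose d := ls - ee Q.
have d0 : 0 <= d by rewrite subr_ge0 hmax.
(* This later turns the square of [d] in the bound on the power into a multiple of [d]. *)
have dls : d <= ls by rewrite gerBl ee_ge0.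
have PQ : pow Q <= Pb by rewrite lerD2r ler_pM2l.
have PQ0 := pow_gt0 pQ.
have h1 : l1 (cov Q - cov Qs) ^+ 2 <= Pb / c * d.
  have := hc Qs Q ls pQs pQ tQs tQ.
  rewrite (ee_pow pQ) (ee_pow pQs) -/ls subrr add0r => h.
  have : \sum_i grad (cov Qs) i (Q i - Qs i) ls <= 0.
    apply: sumr_le0 => i _; apply: first_order => // V pV.
    by apply: hmax; exact: pos_upd.
  move=> h2; rewrite [leRHS]mulrAC ler_pdivlMr // [_ * c]mulrC; move: h2 h.
  move: (ler_wpM2r d0 PQ); rewrite /d; move: (ee Q) (pow Q) (\sum_i _) (l1 _ ^+ 2).
  move=> g p r q; lra.
rewrite -/ls -/d mulrDl lerD // /C2.
have h2 : `|ls * (pow Q - pow Qs)| <= k * l1 (cov Q - cov Qs) + Pb * d.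
  (* Each numerator [a * ld] is the product of value and power. *)
  have -> : ls * (pow Q - pow Qs) = a * (ld (cov Q) - ld (cov Qs)) + pow Q * d.
    have := ee_pow pQ; have := ee_pow pQs; rewrite -/ls /d.
    move: (ld _) (ld _) (pow Q) (pow Qs) (ee Q) => u v p p' g; lra.
  rewrite (le_trans (ler_normD _ _)) // lerD //.
    rewrite normrM (gtr0_norm a0) /k -mulrA ler_pM2l //.
    by apply: ld_lipschitz; exact: psdmx_cov.
  by rewrite ger0_norm ?mulr_ge0 ?(ltW PQ0) // ler_wpM2r.
have h3 : (ls * (pow Q - pow Qs)) ^+ 2 <=
    2 * ((k * l1 (cov Q - cov Qs)) ^+ 2 + (Pb * d) ^+ 2).
  rewrite -[X in X <= _]real_normK ?num_real //.
  set u := k * _; set v := Pb * d in h2 *.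
  have u0 : 0 <= u by rewrite mulr_ge0 ?l1_ge0.
  have v0 : 0 <= v by rewrite mulr_ge0 // ltW.
  rewrite (@le_trans _ _ ((u + v) ^+ 2)) //.
    by rewrite lerXn2r ?nnegrE // addr_ge0.
  have := sqr_ge0 (u - v); rewrite sqrrB sqrrD; lra.
rewrite [leRHS]mulrAC ler_pdivlMr ?exprn_gt0 // mulrC -exprMn (le_trans h3) //.
rewrite -[leRHS]mulrA ler_pM2l // [leRHS]mulrDl lerD //.
  by rewrite exprMn -[leRHS]mulrA ler_wpM2l ?sqr_ge0.
by rewrite exprMn -[leRHS]mulrA ler_wpM2l ?sqr_ge0 // expr2 ler_wpM2r.
Qed.
End Objective.

(** * Polynomial functions with complex and matrix values *)

Section ComplexPolynomialFunctions.
Variables (R : realType) (n : nat).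
Local Notation point := 'rV[R]_n.

Definition cpolyfun (f : point -> R[i]) :=
  polyfun (fun x => complex.Re (f x)) /\ polyfun (fun x => complex.Im (f x)).

Lemma cpolyfunC c : cpolyfun (fun=> c).
Proof. by split; exact: polyfunC. Qed.

Lemma cpolyfunD f g : cpolyfun f -> cpolyfun g -> cpolyfun (fun x => f x + g x).
Proof.
move=> [rf jf] [rg jg]; split.
  have -> : (fun x => complex.Re (f x + g x)) =
      (fun x => complex.Re (f x) + complex.Re (g x)).
    by apply/funext => x; case: (f x); case: (g x).
  exact: polyfunD.
have -> : (fun x => complex.Im (f x + g x)) =
    (fun x => complex.Im (f x) + complex.Im (g x)).
  by apply/funext => x; case: (f x); case: (g x).
exact: polyfunD.
Qed.

Lemma cpolyfunM f g : cpolyfun f -> cpolyfun g -> cpolyfun (fun x => f x * g x).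
Proof.
move=> [rf jf] [rg jg]; split.
  have -> : (fun x => complex.Re (f x * g x)) = (fun x =>
      complex.Re (f x) * complex.Re (g x) + - (complex.Im (f x) * complex.Im (g x))).
    by apply/funext => x; case: (f x); case: (g x).
  by apply: polyfunD; [|apply: polyfunN]; exact: polyfunM.
have -> : (fun x => complex.Im (f x * g x)) = (fun x =>
    complex.Re (f x) * complex.Im (g x) + complex.Im (f x) * complex.Re (g x)).
  by apply/funext => x; case: (f x); case: (g x).
by apply: polyfunD; exact: polyfunM.
Qed.

Lemma cpolyfun_conj f : cpolyfun f -> cpolyfun (fun x => (f x)^*%R).
Proof.
move=> [rf jf]; split.
  have -> // : (fun x => complex.Re (f x)^*%R) = (fun x => complex.Re (f x)).
  by apply/funext => x; case: (f x).
have -> : (fun x => complex.Im (f x)^*%R) = (fun x => - complex.Im (f x)).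
  by apply/funext => x; case: (f x).
exact: polyfunN.
Qed.

Lemma cpolyfun_sum (I : Type) (r : seq I) (F : I -> point -> R[i]) :
  (forall i, cpolyfun (F i)) -> cpolyfun (fun x => \sum_(i <- r) F i x).
Proof.
move=> hF; elim: r => [|i r IHr].
  have -> : (fun x => \sum_(i <- [::]) F i x) = (fun=> 0).
    by apply/funext => x; rewrite big_nil.
  exact: cpolyfunC.
have -> : (fun x => \sum_(i <- i :: r) F i x) =
    (fun x => F i x + \sum_(i <- r) F i x).
  by apply/funext => x; rewrite big_cons.
exact: cpolyfunD.
Qed.

Lemma cpolyfun_prod (I : Type) (r : seq I) (F : I -> point -> R[i]) :
  (forall i, cpolyfun (F i)) -> cpolyfun (fun x => \prod_(i <- r) F i x).
Proof.
move=> hF; elim: r => [|i r IHr].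
  have -> : (fun x => \prod_(i <- [::]) F i x) = (fun=> 1).
    by apply/funext => x; rewrite big_nil.
  exact: cpolyfunC.
have -> : (fun x => \prod_(i <- i :: r) F i x) =
    (fun x => F i x * \prod_(i <- r) F i x).
  by apply/funext => x; rewrite big_cons.
exact: cpolyfunM.
Qed.

Definition mxpolyfun p q (F : point -> 'M[R[i]]_(p, q)) :=
  forall i j, cpolyfun (fun x => F x i j).

Lemma mxpolyfunC p q (A : 'M[R[i]]_(p, q)) : mxpolyfun (fun=> A).
Proof. by move=> i j; exact: cpolyfunC. Qed.

Lemma mxpolyfunD p q (F G : point -> 'M[R[i]]_(p, q)) :
  mxpolyfun F -> mxpolyfun G -> mxpolyfun (fun x => F x + G x).
Proof.
move=> hF hG i j.
have -> : (fun x => (F x + G x) i j) = (fun x => F x i j + G x i j).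
  by apply/funext => x; rewrite mxE.
exact: cpolyfunD (hF i j) (hG i j).
Qed.

Lemma mxpolyfunZ p q (c : R[i]) (F : point -> 'M[R[i]]_(p, q)) :
  mxpolyfun F -> mxpolyfun (fun x => c *: F x).
Proof.
move=> hF i j.
have -> : (fun x => (c *: F x) i j) = (fun x => c * F x i j).
  by apply/funext => x; rewrite mxE.
exact: cpolyfunM (cpolyfunC c) (hF i j).
Qed.

Lemma mxpolyfunM p q r (F : point -> 'M[R[i]]_(p, q)) (G : point -> 'M[R[i]]_(q, r)) :
  mxpolyfun F -> mxpolyfun G -> mxpolyfun (fun x => F x *m G x).
Proof.
move=> hF hG i j.
have -> : (fun x => (F x *m G x) i j) = (fun x => \sum_k F x i k * G x k j).
  by apply/funext => x; rewrite mxE.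
by apply: cpolyfun_sum => k; exact: cpolyfunM (hF i k) (hG k j).
Qed.

Lemma mxpolyfun_adj p q (F : point -> 'M[R[i]]_(p, q)) :
  mxpolyfun F -> mxpolyfun (fun x => (F x)^t*).
Proof.
move=> hF i j.
have -> : (fun x => (F x)^t* i j) = (fun x => (F x j i)^*%R).
  by apply/funext => x; rewrite !mxE.
exact: cpolyfun_conj (hF j i).
Qed.

Lemma mxpolyfun_sum (I : Type) (r : seq I) p q (F : I -> point -> 'M[R[i]]_(p, q)) :
  (forall i, mxpolyfun (F i)) -> mxpolyfun (fun x => \sum_(i <- r) F i x).
Proof.
move=> hF j k.
have -> : (fun x => (\sum_(i <- r) F i x) j k) = (fun x => \sum_(i <- r) F i x j k).
  by apply/funext => x; rewrite summxE.
by apply: cpolyfun_sum => i; exact: hF.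
Qed.

Lemma cpolyfun_det p (F : point -> 'M[R[i]]_p) :
  mxpolyfun F -> cpolyfun (fun x => \det (F x)).
Proof.
move=> hF; apply: cpolyfun_sum => s; apply: cpolyfunM; first exact: cpolyfunC.
by apply: cpolyfun_prod => i; exact: hF.
Qed.
End ComplexPolynomialFunctions.

(** * Tuples of positive semidefinite matrices parametrized by real vectors *)

Section Parametrization.
Variables (R : realType) (K N : nat).
Definition entry_index : finType := ('I_K * 'I_N * 'I_N * bool)%type.
Local Notation point := 'rV[R]_#|entry_index|.

Definition factor (x : point) (i : 'I_K) : 'M[R[i]]_N :=
  \matrix_(j, k) (x 0 (enum_rank ((i, j, k, false) : entry_index)) +i*
                  x 0 (enum_rank ((i, j, k, true) : entry_index))).

Definition gram (x : point) : 'I_K -> 'M[R[i]]_N :=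
  fun i => factor x i *m (factor x i)^t*.

Lemma mxpolyfun_factor i : mxpolyfun (fun x => factor x i).
Proof.
move=> j k; split.
  have -> : (fun x => complex.Re (factor x i j k)) =
      (fun x : point => x 0 (enum_rank ((i, j, k, false) : entry_index))).
    by apply/funext => x; rewrite mxE.
  exact: polyfunX.
have -> : (fun x => complex.Im (factor x i j k)) =
    (fun x : point => x 0 (enum_rank ((i, j, k, true) : entry_index))).
  by apply/funext => x; rewrite mxE.
exact: polyfunX.
Qed.

Lemma mxpolyfun_gram i : mxpolyfun (fun x => gram x i).
Proof.
apply: mxpolyfunM; first exact: mxpolyfun_factor.
exact/mxpolyfun_adj/mxpolyfun_factor.
Qed.

Lemma sum_entry_index (F : 'I_#|entry_index| -> R) :
  \sum_m F m = \sum_i \sum_j \sum_k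
    (F (enum_rank ((i, j, k, false) : entry_index)) +
     F (enum_rank ((i, j, k, true) : entry_index))).
Proof.
rewrite (reindex (@enum_rank entry_index)) /=; last exact/onW_bij/enum_rank_bij.
pose G (ijk : 'I_K * 'I_N * 'I_N) b := F (enum_rank ((ijk, b) : entry_index)).
rewrite (eq_bigr (fun m : entry_index => G m.1 m.2)) => [|[] //].
rewrite -(pair_bigA _ G) /=.
pose G2 (ij : 'I_K * 'I_N) k := \sum_b G (ij, k) b.
rewrite (eq_bigr (fun ijk => G2 ijk.1 ijk.2)) => [|[] //].
rewrite -(pair_bigA _ G2) /=; pose G3 i j := \sum_k G2 (i, j) k.
rewrite (eq_bigr (fun ij => G3 ij.1 ij.2)) => [|[] //].
rewrite -(pair_bigA _ G3) /=.
do 3![apply: eq_bigr => ? _].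
by rewrite /G2 big_bool addrC.
Qed.

Lemma nc_sqr (a b : R) : nc (a +i* b) ^+ 2 = a ^+ 2 + b ^+ 2.
Proof. by rewrite /nc normc_def /= sqr_sqrtr // addr_ge0 // sqr_ge0. Qed.

(** Through this identity a bound on the power becomes a ball of the parameter space, where
    compactness and the Lojasiewicz inequality are available. *)
Lemma trsum_gram x : trsum (gram x) = sqn x.
Proof.
rewrite /sqn sum_entry_index; apply: eq_bigr => i _; rewrite retr_gram.
do 2![apply: eq_bigr => ? _].
by rewrite mxE nc_sqr.
Qed.

Lemma pos_gram x : pos (gram x).
Proof. by move=> i; exact: psdmx_gram. Qed.

Lemma gram_surj (Q : 'I_K -> 'M[R[i]]_N) : pos Q -> exists x, gram x = Q.
Proof.
move=> /(_ _)/psdmx_factor pQ; pose B i := sval (cid (pQ i)).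
have QE i : Q i = B i *m (B i)^t* := svalP (cid (pQ i)).
pose f (m : entry_index) := let: (i, j, k, b) := m in
  if b then complex.Im (B i j k) else complex.Re (B i j k).
exists (\row_m f (enum_val m)); apply/funext => i; rewrite QE /gram.
have -> // : factor (\row_m f (enum_val m)) i = B i.
by apply/matrixP => j k; rewrite !mxE !enum_rankK /=; case: (B i j k).
Qed.

Lemma l1_factor_le x i : l1 (factor x i) <= N%:R * N%:R * (1 + sqn x).
Proof.
rewrite (le_trans (l1_le_gram _)) // ler_wpM2l ?mulr_ge0 // lerD2l.
rewrite -trsum_gram /trsum (bigD1 i) //= lerDl.
by apply: sumr_ge0 => j _; exact/retr_psd_ge0/pos_gram.
Qed.

Lemma l1_factorB_le x y i :
  l1 (factor x i - factor y i) ^+ 2 <= (N * N)%:R ^+ 2 * sqn (x - y).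
Proof.
have BE : factor x i - factor y i = factor (x - y) i.
  by apply/matrixP => j k; rewrite !mxE.
have nc_le_sqn j k : nc (factor (x - y) i j k) <= Num.sqrt (sqn (x - y)).
  rewrite -[X in X <= _]ger0_norm ?nc_ge0 // -sqrtr_sqr ler_wsqrtr //.
  rewrite -trsum_gram /trsum (bigD1 i) //= retr_gram (bigD1 j) //= (bigD1 k) //=.
  rewrite -!addrA lerDl !addr_ge0 //; do ?[apply: sumr_ge0 => ? _] => //.
  - exact: sqr_ge0.
  - exact: sqr_ge0.
  - exact/retr_psd_ge0/psdmx_gram.
rewrite BE -[X in _ <= _ * X]sqr_sqrtr ?sqn_ge0 // -exprMn.
rewrite lerXn2r ?nnegrE ?l1_ge0 ?mulr_ge0 ?sqrtr_ge0 // l1.unlock.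
rewrite (@le_trans _ _ (\sum_(j < N) \sum_(k < N) Num.sqrt (sqn (x - y)))) //.
  by do 2![apply: ler_sum => ? _].
by rewrite !sumr_const !card_ord natrM -mulrA !mulr_natl.
Qed.

Lemma l1_gramB_le x y i (rho : R) : sqn x <= rho -> sqn y <= rho ->
  l1 (gram x i - gram y i) ^+ 2 <=
  (N%:R * N%:R * (1 + rho) *+ 2 * (N * N)%:R) ^+ 2 * sqn (x - y).
Proof.
move=> hx hy; set b := N%:R * N%:R * (1 + rho).
have bnd z : sqn z <= rho -> l1 (factor z i) <= b.
  by move=> hz; rewrite (le_trans (l1_factor_le _ _)) // ler_wpM2l ?mulr_ge0 // lerD2l.
have b0 : 0 <= b := le_trans (l1_ge0 _) (bnd x hx).
rewrite exprMn -mulrA (@le_trans _ _ ((b *+ 2) ^+ 2 * l1 (factor x i - factor y i) ^+ 2)) //; last first.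
  by rewrite ler_wpM2l ?sqr_ge0 // l1_factorB_le.
rewrite -exprMn lerXn2r ?nnegrE ?l1_ge0 ?mulr_ge0 ?l1_ge0 ?mulrn_wge0 //.
have -> : gram x i - gram y i = (factor x i - factor y i) *m (factor x i)^t* +
    factor y i *m (factor x i - factor y i)^t*.
  by rewrite adjB mulmxBl mulmxBr addrA subrK.
rewrite (le_trans (l1D _ _)) // mulr2n mulrDl lerD //.
  by rewrite (le_trans (l1M _ _)) // l1_adj mulrC ler_wpM2r ?l1_ge0 // bnd.
by rewrite (le_trans (l1M _ _)) // l1_adj ler_wpM2r ?l1_ge0 // bnd.
Qed.
End Parametrization.

(** * Existence of maximizers and the Hoelder error bound *)

Section Maximizers.
Variables (R : realType) (M N K : nat) (H : 'I_K -> 'M[R[i]]_(N, M)).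
Variables (a s e c0 : R).
Hypotheses (a0 : 0 < a) (s0 : 0 < s) (e0 : 0 < e) (c00 : 0 < c0).
Local Notation tuple := ('I_K -> 'M[R[i]]_N).
Local Notation covH := (covH H).
Local Notation cov := (cov H s).
Local Notation pow := (pow e c0).
Local Notation ee := (ee H a s e c0).
Implicit Types Q : tuple.

Lemma mxpolyfun_cov : mxpolyfun (fun x => cov (gram x)).
Proof.
rewrite cov.unlock; apply: mxpolyfunD; first exact: mxpolyfunC.
apply: mxpolyfunZ; apply: mxpolyfun_sum => i; rewrite covH.unlock.
apply: mxpolyfunM; last exact: mxpolyfunC.
by apply: mxpolyfunM; [exact: mxpolyfunC | exact: mxpolyfun_gram].
Qed.

Lemma polyfun_pow : polyfun (fun x => pow (gram (K := K) (N := N) x)).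
Proof.
have -> : (fun x => pow (gram (K := K) (N := N) x)) = (fun x => e * sqn x + c0).
  by apply/funext => x; rewrite /pow trsum_gram.
apply: polyfunD; last exact: polyfunC.
by apply: polyfunM; [exact: polyfunC | exact: polyfun_sqn].
Qed.

Lemma continuous_ee : continuous (fun x => ee (gram x)).
Proof.
have gen (T : topologicalType) (x : T) (u p : T -> R) :
    {for x, continuous u} -> {for x, continuous p} -> 0 < u x -> p x != 0 ->
    {for x, continuous (fun y => a * ln (u y) / p y)}.
  move=> cu cp u0 p0; apply: cvgM; last exact: cvgV.
  apply: cvgM; first exact: cvg_cst.
  by apply: (@continuous_comp _ _ _ u (@ln R)) => //; exact: continuous_ln.
move=> x; have [pdet _] := cpolyfun_det mxpolyfun_cov.
have -> : (fun x => ee (gram x)) = (fun x =>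
    a * ln (complex.Re (\det (cov (gram x)))) / pow (gram x)).
  by apply/funext => y; rewrite /ee ld.unlock.
refine (gen _ x (fun x => complex.Re (\det (cov (gram x))))
  (fun x => pow (gram x)) _ _ _ _).
- exact: (polyfun_continuous pdet).
- exact: (polyfun_continuous polyfun_pow).
- by have [] := pd_inv (psdmx_cov H s0 (pos_gram x)).
- by rewrite gt_eqF // pow_gt0 //; exact: pos_gram.
Qed.

(** By coercivity, all tuples that are at least as good as [Q0] have parameters in one compact ball;
    the others are beaten by [Q0]. *)
Lemma exists_maximizer Q0 : pos Q0 -> 0 < ee Q0 ->
  exists2 Qs, pos Qs & forall Q, pos Q -> ee Q <= ee Qs.
Proof.
move=> pQ0 l0; have [beta hb] := ee_coercive H a0 s0 e0 c00 l0.
have [x0 x0E] := gram_surj pQ0.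
have [x _ hx] : exists2 x, x \in [set x | sqn x <= beta]%classic &
    forall y, y \in [set x | sqn x <= beta]%classic -> ee (gram y) <= ee (gram x).
  apply: compact_EVT_max; last by apply: continuous_subspaceT; exact: continuous_ee.
    by exists x0; rewrite /= -trsum_gram x0E; apply: hb.
  exact: compact_sqn_le.
exists (gram x); first exact: pos_gram.
have xmax y : sqn y <= beta -> ee (gram y) <= ee (gram x).
  by move=> hy; apply: hx; rewrite inE.
move=> Q pQ; have [lQ|/ltW Ql] := leP (ee Q0) (ee Q).
  have [y yE] := gram_surj pQ; rewrite -yE; apply: xmax.
  by rewrite -trsum_gram yE; apply: hb.
by rewrite (le_trans Ql) // -x0E xmax // -trsum_gram x0E; apply: hb.
Qed.

(** The pair of [cov] and [pow] determines [ee], so the zeros parametrize tuples with the value of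
    [Qs]; when [Qs] is a maximizer, [gap_bound] bounds this polynomial by the gap. *)
Definition gap_poly (Qs : tuple) (x : 'rV[R]_#|entry_index K N|) : R :=
  (\sum_j \sum_k (complex.Re ((cov (gram x) - cov Qs) j k) ^+ 2 +
                  complex.Im ((cov (gram x) - cov Qs) j k) ^+ 2)) +
  (pow (gram x) - pow Qs) ^+ 2.

Lemma polyfunX2 n (f : 'rV[R]_n -> R) : polyfun f -> polyfun (fun x => f x ^+ 2).
Proof. by move=> hf; exact: polyfunM. Qed.

Lemma polyfun_gap Qs : polyfun (gap_poly Qs).
Proof.
have hc : mxpolyfun (fun x => cov (gram x) - cov Qs).
  by apply: mxpolyfunD; [exact: mxpolyfun_cov | exact: mxpolyfunC].
apply: polyfunD; last first.
  by apply: polyfunX2; apply: polyfunD; [exact: polyfun_pow | exact: polyfunC].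
apply: polyfun_sum => j; apply: polyfun_sum => k; have [hr hi] := hc j k.
by apply: polyfunD; apply: polyfunX2.
Qed.

Lemma gap_poly_ge0 Qs x : 0 <= gap_poly Qs x.
Proof.
rewrite addr_ge0 ?sqr_ge0 //; do 2![apply: sumr_ge0 => ? _].
by rewrite addr_ge0 ?sqr_ge0.
Qed.

Lemma gap_poly_eq0 Qs x : gap_poly Qs x = 0 ->
  cov (gram x) = cov Qs /\ pow (gram x) = pow Qs.
Proof.
move=> /eqP; rewrite paddr_eq0 ?sqr_ge0 //; last first.
  by do 2![apply: sumr_ge0 => ? _]; rewrite addr_ge0 ?sqr_ge0.
rewrite sqrf_eq0 subr_eq0 => /andP[h /eqP]; split=> //.
apply/matrixP => j k; apply/eqP; rewrite -subr_eq0; move: h.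
have n0 z : 0 <= complex.Re z ^+ 2 + complex.Im z ^+ 2 :> R.
  by rewrite addr_ge0 ?sqr_ge0.
rewrite psumr_eq0 => [/allP/(_ j (mem_index_enum _))|? _]; last exact: sumr_ge0.
rewrite /= psumr_eq0 => [/allP/(_ k (mem_index_enum _))|? _] //.
rewrite /= paddr_eq0 ?sqr_ge0 // !sqrf_eq0 !mxE => /andP[h1 h2].
by rewrite eq_complex h1 h2.
Qed.

Lemma gap_poly_le Qs x : gap_poly Qs x <=
  l1 (cov (gram x) - cov Qs) ^+ 2 + (pow (gram x) - pow Qs) ^+ 2.
Proof.
rewrite lerD2r; set A := _ - _; rewrite expr2 {2}l1.unlock mulr_sumr.
apply: ler_sum => j _; rewrite mulr_sumr; apply: ler_sum => k _.
have -> : complex.Re (A j k) ^+ 2 + complex.Im (A j k) ^+ 2 = nc (A j k) ^+ 2.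
  by case: (A j k) => x1 x2; rewrite nc_sqr.
by rewrite expr2 ler_wpM2r ?nc_ge0 // l1_entry.
Qed.

Lemma hoelder_error_bound Qs (beta : R) : pos Qs -> trsum Qs <= beta ->
  0 < ee Qs -> (forall Q, pos Q -> ee Q <= ee Qs) ->
  exists m : nat, exists2 C, 0 <= C & forall Q, pos Q -> trsum Q <= beta ->
    exists Qo, [/\ pos Qo, ee Qo = ee Qs, trsum Qo = trsum Qs &
      (\sum_i l1 (Qo i - Q i)) ^+ m.+2 <= C * (ee Qs - ee Q)].
Proof.
move=> pQs tQs ls0 hmax.
have [xs xsE] := gram_surj pQs.
have gxs : gap_poly Qs xs = 0.
  apply: le_anti; rewrite gap_poly_ge0 andbT (le_trans (gap_poly_le _ _)) //.
  by rewrite xsE !subrr l1_0 expr0n addr0.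
have [m [C C0 hC]] := lojasiewicz beta (polyfun_gap Qs) (gap_poly_ge0 Qs)
  (ex_intro _ xs gxs).
have [C1 C10 hC1] := gap_bound a0 s0 e0 c00 pQs tQs ls0 hmax.
pose b : R := N%:R * N%:R * (1 + beta) *+ 2 * (N * N)%:R.
pose b2 := (K%:R ^+ 2 * b ^+ 2).
have b20 : 0 <= b2 by rewrite mulr_ge0 // sqr_ge0.
(* [m.*2.+2] is [2 * m.+1]: the Lojasiewicz inequality bounds a power of the squared distance,
   whereas the statement is about the distance. *)
exists (m.*2), (b2 ^+ m.+1 * (C * C1)).
  by rewrite mulr_ge0 ?exprn_ge0 // mulr_ge0.
move=> Q pQ tQ; have [x xE] := gram_surj pQ.
have hx : sqn x <= beta by rewrite -trsum_gram xE.
have [y hy hxy] := hC x hx; have [yX yP] := gap_poly_eq0 hy.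
have ty : trsum (gram y) = trsum Qs.
  by move: yP => /addIr /(mulfI (lt0r_neq0 e0)).
exists (gram y); split.
- exact: pos_gram.
- by rewrite /ee yX yP.
- exact: ty.
have hy' : sqn y <= beta by rewrite -trsum_gram ty.
have hsum : (\sum_i l1 (gram y i - Q i)) ^+ 2 <= b2 * sqn (x - y).
  have r0 : 0 <= `|b| * Num.sqrt (sqn (x - y)) by rewrite mulr_ge0 ?sqrtr_ge0.
  have hi i : l1 (gram y i - Q i) <= `|b| * Num.sqrt (sqn (x - y)).
    rewrite -(@ler_pXn2r _ 2) ?nnegrE ?l1_ge0 //.
    rewrite exprMn real_normK ?num_real // sqr_sqrtr ?sqn_ge0 // l1B -xE.
    exact: l1_gramB_le.
  rewrite (@le_trans _ _ ((K%:R * (`|b| * Num.sqrt (sqn (x - y)))) ^+ 2)) //.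
    rewrite lerXn2r ?nnegrE ?mulr_ge0 ?sqrtr_ge0 // ?sumr_ge0 // => [i _|].
      exact: l1_ge0.
    rewrite (le_trans (ler_sum _ (fun i _ => hi i))) //.
    by rewrite sumr_const card_ord mulr_natl.
  rewrite [in leLHS]exprMn [X in _ * X <= _]exprMn real_normK ?num_real //.
  by rewrite sqr_sqrtr ?sqn_ge0 // mulrA.
rewrite -doubleS -mul2n exprM (@le_trans _ _ ((b2 * sqn (x - y)) ^+ m.+1)) //.
  rewrite lerXn2r ?nnegrE //; first exact: sqr_ge0.
  exact: mulr_ge0 b20 (sqn_ge0 _).
rewrite exprMn -[leRHS]mulrA ler_wpM2l ?exprn_ge0 // (le_trans hxy) //.
rewrite -[leRHS]mulrA ler_wpM2l // (le_trans (gap_poly_le _ _)) // xE.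
exact: hC1.
Qed.
End Maximizers.

(** * Real sequences: summability from a Lojasiewicz inequality, Cauchy sequences *)

Section RealSequences.
Variable R : realType.
Implicit Types (u v : nat -> R).

Lemma subX_le (x y : R) n : 0 <= y -> y <= x ->
  x ^+ n.+1 - y ^+ n.+1 <= n.+1%:R * x ^+ n * (x - y).
Proof.
move=> y0 yx; have x0 := le_trans y0 yx.
elim: n => [|n IHn]; first by rewrite !expr1 expr0 !mul1r.
have -> : x ^+ n.+2 - y ^+ n.+2 =
    x * (x ^+ n.+1 - y ^+ n.+1) + y ^+ n.+1 * (x - y).
  by rewrite !(exprS _ n.+1); ring.
have h1 := ler_wpM2l x0 IHn.
have h2 : y ^+ n.+1 * (x - y) <= x ^+ n.+1 * (x - y).
  by rewrite ler_wpM2r ?subr_ge0 // lerXn2r.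
have -> : n.+2%:R * x ^+ n.+1 * (x - y) =
    x * (n.+1%:R * x ^+ n * (x - y)) + x ^+ n.+1 * (x - y).
  by rewrite -[n.+2]addn1 natrD (exprS _ n); ring.
exact: lerD.
Qed.

(* With [v k = delta k ^ (1 / (m + 2))] for the gap [delta k] of the values, the
   hypothesis is a Lojasiewicz inequality and [sqrt (delta k - delta k.+1)]
   dominates the length of a step. *)
Lemma sqrt_step_telescopes (m : nat) v (C : R) : 0 <= C ->
  (forall k, 0 <= v k) -> (forall k, v k.+1 <= v k) ->
  (forall k, v k.+1 ^+ m.+1 <= C * Num.sqrt (v k ^+ m.+2 - v k.+1 ^+ m.+2)) ->
  exists2 C', 0 <= C' & forall k,
    Num.sqrt (v k ^+ m.+2 - v k.+1 ^+ m.+2) <= C' * (v k - v k.+1).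
Proof.
move=> C0 v0 vS hv.
have v_le k : v k <= v 0%N by elim: k => // k IHk; exact: le_trans (vS k) IHk.
pose C2 := 2 ^+ m.+1 * C + Num.sqrt (2 * v 0%N ^+ m).
have C20 : 0 <= C2 by rewrite addr_ge0 ?sqrtr_ge0 // mulr_ge0 // exprn_ge0.
exists (m.+2%:R * C2) => [|k]; first by rewrite mulr_ge0.
set D := v k ^+ m.+2 - v k.+1 ^+ m.+2.
have D0 : 0 <= D by rewrite subr_ge0 lerXn2r ?nnegrE.
have vk : 0 <= v k - v k.+1 by rewrite subr_ge0.
have [D00|DN0] := eqVneq D 0; first by rewrite D00 sqrtr0 !mulr_ge0.
have sD : 0 < Num.sqrt D by rewrite sqrtr_gt0 lt_neqAle eq_sym DN0.
(* The hypothesis bounds [v k.+1], but [v k] is wanted. Either [v k <= 2 * v k.+1], or the drop [D]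
   exceeds half of [v k ^+ m.+2], and then [v k ^+ m.+1], the square root of
   [v k ^+ m * v k ^+ m.+2], is bounded by a multiple of the square root of [D]. *)
have hC2 : v k ^+ m.+1 <= C2 * Num.sqrt D.
  rewrite /C2 mulrDl; have [Dle|Dgt] := leP D (v k.+1 ^+ m.+2).
    have v2 : v k <= 2 * v k.+1.
      rewrite -(@ler_pXn2r _ m.+2) ?nnegrE ?mulr_ge0 // exprMn.
      have : v k ^+ m.+2 <= 2 * v k.+1 ^+ m.+2 by move: Dle; rewrite /D; lra.
      move/le_trans; apply; rewrite ler_wpM2r ?exprn_ge0 // exprS ler_peMr //.
      by rewrite exprn_ege1 // ler1n.
    rewrite (@le_trans _ _ ((2 * v k.+1) ^+ m.+1)) ?lerXn2r ?nnegrE ?mulr_ge0 //.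
    rewrite exprMn (@le_trans _ _ (2 ^+ m.+1 * (C * Num.sqrt D))) //.
      by rewrite ler_wpM2l ?exprn_ge0 // hv.
    by rewrite mulrA lerDl mulr_ge0 ?sqrtr_ge0.
  rewrite (@le_trans _ _ (Num.sqrt (2 * v 0%N ^+ m) * Num.sqrt D)) //; last first.
    by rewrite lerDr mulr_ge0 ?mulr_ge0 ?sqrtr_ge0 ?exprn_ge0.
  have m0 : 0 <= 2 * v 0%N ^+ m by rewrite mulr_ge0 ?exprn_ge0.
  rewrite -sqrtrM // -(@ler_pXn2r _ 2) ?nnegrE ?sqrtr_ge0 ?exprn_ge0 //.
  rewrite sqr_sqrtr ?(mulr_ge0 m0 D0) // -exprM muln2 -addnn addSn -addnS exprD.
  rewrite [leRHS]mulrAC [leRHS]mulrC ler_pM ?exprn_ge0 //; last first.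
    by move: Dgt; rewrite /D; lra.
  by rewrite lerXn2r ?nnegrE // v_le.
have sE : Num.sqrt D * Num.sqrt D = D by rewrite -expr2 sqr_sqrtr.
(* [D] is at most [m.+2%:R * v k ^+ m.+1 * (v k - v k.+1)]; inserting [hC2] leaves one factor
   [Num.sqrt D] to cancel. *)
rewrite -(ler_pM2l sD) sE (le_trans (subX_le _ (v0 _) (vS k))) //.
rewrite [leRHS]mulrA ler_wpM2r // mulrCA ler_wpM2l // mulrC.
exact: hC2.
Qed.

Definition rcauchy u := forall eps, 0 < eps ->
  exists n, forall p q, (n <= p)%N -> (n <= q)%N -> `|u p - u q| <= eps.

Lemma nonincreasing_rcauchy u (b : R) :
  (forall k, u k.+1 <= u k) -> (forall k, b <= u k) -> rcauchy u.
Proof.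
move=> uS ub eps eps0.
have mono p q : (p <= q)%N -> u q <= u p.
  elim: q => [|q IHq]; first by rewrite leqn0 => /eqP ->.
  rewrite leq_eqVlt => /predU1P[-> //|]; rewrite ltnS => /IHq.
  exact: le_trans (uS q).
have hi : has_inf (range u).
  by split; [exists (u 0%N), 0%N | exists b => _ [k _ <-]].
have [_ [n _ <-] hn] := inf_adherent eps0 hi.
have hb p : inf (range u) <= u p by apply: ge_inf; [exact: hi.2 | exists p].
exists n => p q np nq; have := mono _ _ np; have := mono _ _ nq.
have := hb p; have := hb q; rewrite ler_norml; lra.
Qed.

Lemma rcauchyN u : rcauchy u -> rcauchy (fun k => - u k).
Proof.
move=> h eps /h [n hn]; exists n => p q np nq.
by rewrite -opprD normrN hn.
Qed.

Lemma nondecreasing_rcauchy u (b : R) :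
  (forall k, u k <= u k.+1) -> (forall k, u k <= b) -> rcauchy u.
Proof.
move=> uS ub; have -> : u = (fun k => - - u k) by apply/funext => k; rewrite opprK.
by apply/rcauchyN/(@nonincreasing_rcauchy _ (- b)) => k; rewrite lerN2.
Qed.

Lemma rcauchyV u (l : R) : 0 < l -> (forall k, l <= u k) -> rcauchy u ->
  rcauchy (fun k => (u k)^-1).
Proof.
move=> l0 ul h eps eps0.
have [n hn] := h (eps * (l * l)) (mulr_gt0 eps0 (mulr_gt0 l0 l0)).
exists n => p q np nq; have up := lt_le_trans l0 (ul p).
have uq := lt_le_trans l0 (ul q).
have -> : (u p)^-1 - (u q)^-1 = (u q - u p) / (u p * u q).
  by field; rewrite !gt_eqF.
rewrite normrM normfV (gtr0_norm (mulr_gt0 up uq)) ler_pdivrMr ?mulr_gt0 //.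
by rewrite (le_trans (hn q p nq np)) // ler_pM2l // ler_pM // ltW.
Qed.

Lemma rcauchyZ (c : R) u : rcauchy u -> rcauchy (fun k => c * u k).
Proof.
move=> h eps eps0; have c0 : 0 < `|c| + 1 by rewrite ltr_pwDr.
have [n hn] := h (eps / (`|c| + 1)) (divr_gt0 eps0 c0).
exists n => p q np nq; rewrite -mulrBr normrM.
have := hn p q np nq; rewrite ler_pdivlMr // => h1.
by rewrite (le_trans _ h1) // mulrC ler_wpM2l // lerDl.
Qed.

(** The limit inherits every modulus of the sequence, so that all entries of a matrix can share one
    rank. *)
Lemma rcauchy_limit u : rcauchy u -> exists l, forall eps n,
  (forall p q, (n <= p)%N -> (n <= q)%N -> `|u p - u q| <= eps) ->
  forall p, (n <= p)%N -> `|l - u p| <= eps.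
Proof.
move=> h; have : cvgn u.
  apply/cauchy_cvgP/cauchy_exP => eps eps0.
  have [n hn] := h (eps / 2) (divr_gt0 eps0 (ltr0Sn _ _)).
  exists (u n); exists n => // p /= np.
  by rewrite /ball /= (le_lt_trans (hn n p _ np)) // gtr_pMr // invf_lt1 // ltr1n.
move=> /cvg_ex [l ul]; exists l => eps n hn p np.
apply/ler_addgt0Pr => d d0.
have /cvgrPdist_lt/(_ d d0)[n' _ hn'] := ul.
have := hn' (maxn n n') (leq_maxr _ _) => /= h1.
have h2 := hn (maxn n n') p (leq_maxl _ _) np.
have -> : l - u p = (l - u (maxn n n')) + (u (maxn n n') - u p) by ring.
by rewrite (le_trans (ler_normD _ _)) // addrC lerD // ltW.
Qed.
End RealSequences.

(** * Cauchy sequences of complex matrices *)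

Section MatrixSequences.
Variable R : realType.
Local Notation C := R[i].

(** Working with Cauchy sequences in [l1] confines the topology of complex matrices to
    [mxcauchy_cvg]. *)
Definition mxcauchy p q (u : nat -> 'M[C]_(p, q)) := forall eps, 0 < eps ->
  exists n, forall k l, (n <= k)%N -> (n <= l)%N -> l1 (u k - u l) <= eps.

Lemma mxcauchyC p q (A : 'M[C]_(p, q)) : mxcauchy (fun=> A).
Proof. by move=> eps eps0; exists 0%N => k l _ _; rewrite subrr l1_0 ltW. Qed.

Lemma mxcauchyD p q (u v : nat -> 'M[C]_(p, q)) :
  mxcauchy u -> mxcauchy v -> mxcauchy (fun k => u k + v k).
Proof.
move=> hu hv eps eps0; have e20 : 0 < eps / 2 by rewrite divr_gt0.
have [n1 h1] := hu _ e20; have [n2 h2] := hv _ e20.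
exists (maxn n1 n2) => k l; rewrite !geq_max => /andP[k1 k2] /andP[l1' l2].
rewrite opprD addrACA (le_trans (l1D _ _)) //.
by rewrite [leRHS]splitr lerD ?h1 ?h2.
Qed.

Lemma mxcauchy_sum (I : Type) (r : seq I) p q (u : I -> nat -> 'M[C]_(p, q)) :
  (forall i, mxcauchy (u i)) -> mxcauchy (fun k => \sum_(i <- r) u i k).
Proof.
move=> hu; elim: r => [|i r IHr].
  have -> : (fun k => \sum_(i <- [::]) u i k) = (fun=> 0).
    by apply/funext => k; rewrite big_nil.
  exact: mxcauchyC.
have -> : (fun k => \sum_(i <- i :: r) u i k) =
    (fun k => u i k + \sum_(i <- r) u i k).
  by apply/funext => k; rewrite big_cons.
exact: mxcauchyD.
Qed.

Lemma mxcauchy_bounded p q (u : nat -> 'M[C]_(p, q)) : mxcauchy u ->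
  exists n, exists2 b, 0 < b & forall k, (n <= k)%N -> l1 (u k) <= b.
Proof.
move=> /(_ 1 ltr01) [n hn]; exists n, (1 + l1 (u n)).
  by rewrite ltr_pwDl // l1_ge0.
move=> k nk; rewrite -[u k](subrK (u n)) (le_trans (l1D _ _)) // lerD2r.
exact: hn.
Qed.

Lemma mxcauchyM p q r (u : nat -> 'M[C]_(p, q)) (v : nat -> 'M[C]_(q, r)) :
  mxcauchy u -> mxcauchy v -> mxcauchy (fun k => u k *m v k).
Proof.
move=> hu hv eps eps0.
have [n3 [b b0 hb]] := mxcauchy_bounded hu.
have [n4 [c c0 hc]] := mxcauchy_bounded hv.
have [n1 h1] := hu _ (divr_gt0 (divr_gt0 eps0 (ltr0Sn _ 1)) c0).
have [n2 h2] := hv _ (divr_gt0 (divr_gt0 eps0 (ltr0Sn _ 1)) b0).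
exists (maxn (maxn n1 n2) (maxn n3 n4)) => k l.
rewrite !geq_max => /andP[/andP[k1 k2] /andP[k3 k4]] /andP[/andP[l1' l2] /andP[l3 l4]].
have -> : u k *m v k - u l *m v l = (u k - u l) *m v k + u l *m (v k - v l).
  by rewrite mulmxBl mulmxBr addrA subrK.
have hk := ler_pM (l1_ge0 _) (l1_ge0 _) (h1 k l k1 l1') (hc k k4).
have hl := ler_pM (l1_ge0 _) (l1_ge0 _) (hb l l3) (h2 k l k2 l2).
rewrite (le_trans (l1D _ _)) // [leRHS]splitr lerD // (le_trans (l1M _ _)) //.
  by rewrite (le_trans hk) // divfK // gt_eqF.
by rewrite (le_trans hl) // mulrC divfK // gt_eqF.
Qed.

Lemma mxcauchyZ p q (x : nat -> R) (u : nat -> 'M[C]_(p, q)) :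
  rcauchy x -> mxcauchy u -> mxcauchy (fun k => (x k)%:C *: u k).
Proof.
move=> hx hu.
have -> : (fun k => (x k)%:C *: u k) = (fun k => (x k)%:C *: 1%:M *m u k).
  by apply/funext => k; rewrite -scalemxAl mul1mx.
apply: mxcauchyM hu => eps eps0.
have l0 : 0 < l1 (1%:M : 'M[C]_p) + 1 by rewrite ltr_pwDr // l1_ge0.
have [n hn] := hx _ (divr_gt0 eps0 l0); exists n => k l nk nl.
rewrite -scalerBl -rmorphB l1Z; have := hn k l nk nl; rewrite ler_pdivlMr //.
by apply: le_trans; rewrite ler_wpM2l // lerDl.
Qed.

Lemma mxcauchyV n (u : nat -> 'M[C]_n) : (forall k, psdmx (u k - 1%:M)) ->
  mxcauchy u -> mxcauchy (fun k => invmx (u k)).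
Proof.
move=> pu hu eps eps0.
have n0 : 0 < n%:R ^+ 6 + 1 :> R by rewrite ltr_pwDr // exprn_ge0.
have [m hm] := hu _ (divr_gt0 eps0 n0); exists m => k l mk ml.
rewrite (le_trans (l1_invB (pu k) (pu l))) //.
have := hm k l mk ml; rewrite ler_pdivlMr //; apply: le_trans.
by rewrite mulrC ler_wpM2l ?l1_ge0 // lerDl.
Qed.

Lemma mxcauchyS p q (u : nat -> 'M[C]_(p, q)) : mxcauchy u ->
  mxcauchy (fun k => u k.+1).
Proof.
move=> hu eps /hu [n hn]; exists n => k l nk nl; apply: hn; exact: leqW.
Qed.

Lemma mxcauchy_shift p q (u : nat -> 'M[C]_(p, q)) :
  mxcauchy (fun k => u k.+1) -> mxcauchy u.
Proof.
by move=> hu eps /hu [n hn]; exists n.+1 => -[//|k] [//|l]; exact: hn.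
Qed.

Lemma mxcauchy_telescope p q (u : nat -> 'M[C]_(p, q)) (v : nat -> R) (c : R) :
  0 <= c -> (forall k, 0 <= v k) -> (forall k, v k.+1 <= v k) ->
  (forall k, l1 (u k.+1 - u k) <= c * (v k - v k.+1)) -> mxcauchy u.
Proof.
move=> c0 v0 vS h.
have dist k j : l1 (u (k + j)%N - u k) <= c * (v k - v (k + j)%N).
  elim: j => [|j IHj]; first by rewrite addn0 !subrr l1_0 mulr0.
  have -> : u (k + j.+1)%N - u k = (u (k + j).+1 - u (k + j)%N) + (u (k + j)%N - u k).
    by rewrite addnS addrA subrK.
  rewrite (le_trans (l1D _ _)) // addnS; have := h (k + j)%N.
  move: IHj; move: (l1 _) (l1 _) => x y; lra.
move=> eps eps0; have c1 : 0 < c + 1 by rewrite ltr_pwDr.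
have [n hn] := nonincreasing_rcauchy vS v0 (divr_gt0 eps0 c1).
exists n => k l nk nl; wlog kl : k l nk nl / (k <= l)%N.
  by move=> hw; have [|/ltnW] := leqP k l; [exact: hw | rewrite l1B; exact: hw].
rewrite l1B -(subnKC kl) (le_trans (dist _ _)) // subnKC //.
have := hn k l nk nl; rewrite ler_pdivlMr // => h1.
rewrite (le_trans _ h1) // mulrC (le_trans (ler_wpM2r c0 (ler_norm _))) //.
by rewrite ler_wpM2l // lerDl.
Qed.
End MatrixSequences.

Lemma mxcauchy_cvg (R : realType) n (u : nat -> 'M[R[i]]_n) : mxcauchy u ->
  exists L : 'M[R[i]^o]_n, ((u k : 'M[R[i]^o]_n) @[k --> \oo] --> L)%classic.
Proof.
move=> hu.
have hr i j : rcauchy (fun k => complex.Re (u k i j)).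
  move=> eps /hu [m hm]; exists m => k l mk ml; rewrite -ReB.
  have := l1_entry (u k - u l) i j; rewrite !mxE => h.
  by rewrite (le_trans (ler_Re_nc _)) // (le_trans h) // hm.
have ImB (z w : R[i]) : complex.Im (z - w) = complex.Im z - complex.Im w.
  by case: z; case: w.
have hi i j : rcauchy (fun k => complex.Im (u k i j)).
  move=> eps /hu [m hm]; exists m => k l mk ml; rewrite -ImB.
  have := l1_entry (u k - u l) i j; rewrite !mxE => h.
  by rewrite (le_trans (ler_Im_nc _)) // (le_trans h) // hm.
pose L : 'M[R[i]^o]_n := \matrix_(i, j)
  (sval (cid (rcauchy_limit (hr i j))) +i* sval (cid (rcauchy_limit (hi i j)))).
exists L; apply/cvg_ballP => eps eps0.
(* Radii of balls are positive elements of [R[i]], hence real. *)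
have epsE : eps = (complex.Re eps)%:C by rewrite RRe_real // gtr0_real.
have re0 : 0 < complex.Re eps by rewrite -ltcR -epsE.
have [m hm] := hu _ (divr_gt0 re0 (ltr0Sn _ 3)).
exists m => // k /= mk; split=> // i j; rewrite /ball /= epsE ncE ltcR.
rewrite (le_lt_trans (nc_le _)) // ReB ImB mxE /=.
have hmE p q : (m <= p)%N -> (m <= q)%N ->
    nc (u p i j - u q i j) <= complex.Re eps / 4.
  move=> mp mq; have := l1_entry (u p - u q) i j; rewrite !mxE => h.
  by rewrite (le_trans h) // hm.
have h1 : `|sval (cid (rcauchy_limit (hr i j))) - complex.Re (u k i j)| <=
    complex.Re eps / 4.
  case: cid => l /= hl; apply: (hl _ m) => // p q mp mq.
  by rewrite -ReB (le_trans (ler_Re_nc _)) // hmE.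
have h2 : `|sval (cid (rcauchy_limit (hi i j))) - complex.Im (u k i j)| <=
    complex.Re eps / 4.
  case: cid => l /= hl; apply: (hl _ m) => // p q mp mq.
  by rewrite -ImB (le_trans (ler_Im_nc _)) // hmE.
rewrite (le_lt_trans (lerD h1 h2)) //; lra.
Qed.

(** * Recovering a block from its stationarity equation *)

Section Stationarity.
Variable R : realType.
Local Notation C := R[i].

(** Self-duality of the semidefinite cone, tested on the rank-one matrices [x *m x^t*]. *)
Lemma psdmx_retr n (Z : 'M[C]_n) : Z^t* = Z ->
  (forall V, psdmx V -> 0 <= retr (Z *m V)) -> psdmx Z.
Proof.
move=> hZ h; split; first exact/hermE.
move=> x; set y := x^t* *m Z *m x.
have hy : y^t* = y by rewrite /y adjM adjM adjK hZ mulmxA.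
have y0 : retr y = complex.Re (y 0 0) by rewrite retr.unlock trace_mx11.
rewrite lecE -y0 /y -mulmxA retr_mulC -mulmxA h ?andbT; last exact: psdmx_gram.
have im0 (w : 'M[C]_1) : w^t* = w -> complex.Im (w 0 0) = 0.
  by move=> /matrixP/(_ 0 0); rewrite !mxE; case: (w 0 0) => u v [] /= vE; lra.
by rewrite /= mulmxA -/y im0.
Qed.

(** With factors [D] and [B], the trace is the sum of the squared moduli of the entries of
    [D^t* *m B]. *)
Lemma psdmx_mul_eq0 n (Z Q : 'M[C]_n) : psdmx Z -> psdmx Q ->
  retr (Z *m Q) = 0 -> Z *m Q = 0.
Proof.
move=> /psdmx_factor [D ->] /psdmx_factor [B ->] h.
have DB0 : D^t* *m B = 0.
  apply: gram_eq0; rewrite adjM adjK -h retr_mulC !mulmxA.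
  by rewrite -!mulmxA retr_mulC !mulmxA.
by rewrite mulmxA -(mulmxA D) DB0 mulmx0 mul0mx.
Qed.

Variables (M N K : nat) (H : 'I_K -> 'M[C]_(N, M)) (a s e c0 : R).
Hypotheses (a0 : 0 < a) (s0 : 0 < s) (e0 : 0 < e) (c00 : 0 < c0).
Local Notation covH := (covH H).
Local Notation cov := (cov H s).
Local Notation ee := (ee H a s e c0).

(* The first-order conditions say that [Z = lambda e I - a s H X^-1 H^*] is
   positive semidefinite and orthogonal to [Q i], hence that [Z *m Q i = 0];
   so [Q i] is determined by [X], [lambda] and the received covariance. *)
Lemma stationary_block Q i : pos Q -> 0 < ee Q ->
  (forall V, psdmx V -> ee (upd Q i V) <= ee Q) ->
  let G := (a * s / e * (ee Q)^-1)%:C *: (H i *m invmx (cov Q)) in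
  Q i = G *m covH i (Q i) *m G^t*.
Proof.
move=> pQ l0 hmax G; pose l := ee Q; pose X := cov Q.
have [_ pX _ _] := pd_inv (psdmx_cov H s0 pQ).
have hX : (invmx X)^t* = invmx X := psdmx_adj pX.
have [A AE hA] : exists2 A, A = H i *m invmx X *m (H i)^t* & A^t* = A.
  by eexists; [reflexivity | rewrite adjM adjK adjM hX mulmxA].
have trA V : retr (invmx X *m covH i V) = retr (A *m V).
  by rewrite covH.unlock AE -!mulmxA [in RHS]retr_mulC !mulmxA.
pose Z := (l * e)%:C *: 1%:M - (a * s)%:C *: A.
have hZ : Z^t* = Z by rewrite /Z adjB !adjZ adj1 hA.
have gradE V : grad H a s e X i V l = - retr (Z *m V).
  by rewrite /grad trA mulmxBl -!scalemxAl retrB !retrZ mul1mx opprB.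
have fo V : psdmx V -> 0 <= retr (Z *m (V - Q i)).
  by move=> pV; rewrite -oppr_le0 -gradE; exact: first_order.
(* Testing with [V = 0] and with [V = Q i + Q i] gives both inequalities. *)
have ZQ0 : retr (Z *m Q i) = 0.
  apply: le_anti; have := fo _ (psdmx0 _ _); rewrite sub0r mulmxN retrN oppr_ge0.
  move=> ->; have := fo _ (psdmxD (pQ i) (pQ i)).
  by rewrite addrK.
have pZ : psdmx Z.
  apply: psdmx_retr hZ _ => V pV.
  by have := fo _ (psdmxD pV (pQ i)); rewrite addrK.
have {}ZQ0 := psdmx_mul_eq0 pZ (pQ i) ZQ0.
have le0 : 0 < l * e by rewrite mulr_gt0.
pose k := a * s / e * l^-1.
have kE : k = (l * e)^-1 * (a * s).
  by rewrite /k -mulrA -invfM mulrC [e * l]mulrC.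
have QE : Q i = k%:C *: (A *m Q i).
  move: ZQ0; rewrite mulmxBl -!scalemxAl mul1mx => /eqP; rewrite subr_eq0 => /eqP h.
  rewrite kE rmorphM -scalerA -h scalerA -rmorphM mulVf ?gt_eqF //.
  by rewrite rmorph1 scale1r.
have QE' : Q i = k%:C *: (Q i *m A).
  have := congr1 (fun B : 'M[C]_N => B^t* ) QE.
  by rewrite adjZ adjM hA (psdmx_adj (pQ i)).
have GE : G = k%:C *: (H i *m invmx X) by [].
have GH : G *m (H i)^t* = k%:C *: A by rewrite GE -scalemxAl AE.
have HG : H i *m G^t* = k%:C *: A.
  by rewrite -hA -adjZ -GH adjM adjK.
(* Multiplication by [k%:C *: A] fixes [Q i] on either side, and the right-hand side performs
   both. *)
rewrite covH.unlock !mulmxA GH -mulmxA HG -scalemxAl -QE -scalemxAr.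
exact: QE'.
Qed.
End Stationarity.

(** * Convergence of the iterates *)

Section Waterfilling.
Variables (R : realType) (M N K : nat) (H : 'I_K.+1 -> 'M[R[i]]_(N, M)).
Variables (a s e c0 : R).
Hypotheses (a0 : 0 < a) (s0 : 0 < s) (e0 : 0 < e) (c00 : 0 < c0).
Hypothesis hH : forall i, H i != 0.
Local Notation tuple := ('I_K.+1 -> 'M[R[i]]_N).
Local Notation covH := (covH H).
Local Notation cov := (cov H s).
Local Notation pow := (pow e c0).
Local Notation ee := (ee H a s e c0).
Variable Q : nat -> tuple.
Hypothesis hQ : iterative_waterfilling ee Q.

Definition partial k (j : nat) : tuple :=
  fun i => if (i < j)%N then Q k.+1 i else Q k i.

Lemma partial0 k : partial k 0 = Q k.
Proof. by []. Qed.

Lemma partialK k : partial k K.+1 = Q k.+1.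
Proof. by apply/funext => i; rewrite /partial ltn_ord. Qed.

Lemma pos_iterate k : pos (Q k).
Proof.
case: hQ => hQ0 hQS; case: k => [|k] i; last by case: (hQS k i).
by rewrite hQ0; exact: psdmx0.
Qed.

Lemma pos_partial k j : pos (partial k j).
Proof. by move=> i; rewrite /partial; case: ifP => _; exact: pos_iterate. Qed.

(** Block [i] is overwritten, so the tuple after its update can replace the tuple before it;
    optimality is then a statement about [partial k i.+1] itself. *)
Lemma sweep_point_upd k (i : 'I_K.+1) V :
  sweep_point (Q k.+1) (Q k) i V = upd (partial k i.+1) i V.
Proof.
apply/funext => j; rewrite /sweep_point /upd /partial ltnS [(j <= i)%N]leq_eqVlt -val_eqE /=.
by case: (ltngtP j i).
Qed.

Lemma partialS k (i : 'I_K.+1) :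
  partial k i.+1 = upd (partial k i) i (Q k.+1 i).
Proof.
apply/funext => j; rewrite /upd /partial ltnS [(j <= i)%N]leq_eqVlt -val_eqE /=.
by case: (ltngtP j i) => // /val_inj ->.
Qed.

Lemma partialS_same k (i : 'I_K.+1) : partial k i.+1 i = Q k.+1 i.
Proof. by rewrite /partial ltnS leqnn. Qed.

Lemma partial_other k (i j : 'I_K.+1) : j != i -> partial k i.+1 j = partial k i j.
Proof. by rewrite partialS /upd => /negbTE ->. Qed.

Lemma block_optimal k (i : 'I_K.+1) V : psdmx V ->
  ee (upd (partial k i.+1) i V) <= ee (partial k i.+1).
Proof.
have E : upd (partial k i.+1) i (Q k.+1 i) = partial k i.+1.
  by rewrite -[in LHS](partialS_same k i) upd_id.
by case: hQ => _ /(_ k i) [_ h] /h; rewrite !sweep_point_upd E.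
Qed.

Lemma ee_partialS k (i : 'I_K.+1) : ee (partial k i) <= ee (partial k i.+1).
Proof.
have -> : partial k i = upd (partial k i.+1) i (Q k i).
  apply/funext => j; rewrite /upd; have [->|/partial_other -> //] := eqVneq j i.
  by rewrite /partial ltnn.
exact/block_optimal/pos_iterate.
Qed.

Lemma ee_partial_mono k j l : (j <= l)%N -> (l <= K.+1)%N ->
  ee (partial k j) <= ee (partial k l).
Proof.
elim: l => [|l IHl]; first by rewrite leqn0 => /eqP ->.
rewrite leq_eqVlt => /predU1P[-> //|]; rewrite ltnS => jl lK.
rewrite (le_trans (IHl jl (ltnW lK))) //.
exact: (ee_partialS k (Ordinal lK)).
Qed.

Lemma ee_mono k : ee (Q k) <= ee (Q k.+1).
Proof. by rewrite -{1}(partial0 k) -(partialK k) ee_partial_mono. Qed.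

Lemma ee_mono_le k l : (k <= l)%N -> ee (Q k) <= ee (Q l).
Proof.
elim: l => [|l IHl]; first by rewrite leqn0 => /eqP ->.
rewrite leq_eqVlt => /predU1P[-> //|]; rewrite ltnS => /IHl /le_trans; apply.
exact: ee_mono.
Qed.

(** The first update does at least as well as giving the identity to user [ord0], whose received
    covariance is nonzero because [H ord0] is. *)
Lemma ee_first_gt0 : 0 < ee (partial 0 1).
Proof.
have h := @block_optimal 0%N ord0 1%:M (psdmx1 _ _).
apply: lt_le_trans h; set Q' := upd _ _ _.
have pQ' : pos Q' by apply: pos_upd; [exact: pos_partial | exact: psdmx1].
rewrite /ee divr_gt0 ?pow_gt0 // mulr_gt0 // ld_gt0 //.
  exact: (psdmx_cov H s0 pQ').
have Q'E j : Q' j = if j == ord0 then 1%:M else 0.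
  rewrite /Q' /upd; case: eqP => // /eqP; rewrite /partial -val_eqE /= => j0.
  by case: hQ => hQ0 _; rewrite ltnS leqn0 (negbTE j0) hQ0.
rewrite cov.unlock -subr_eq0 addrC addKr scaler_eq0 negb_or.
have -> : s%:C != 0 :> R[i] by rewrite eq_complex /= eqxx andbT gt_eqF.
rewrite (bigD1 ord0) //= big1 => [|j /negbTE j0]; last by rewrite Q'E j0 covH0.
rewrite addr0 Q'E eqxx covH.unlock mulmx1; apply: contra (hH ord0) => /eqP h.
by apply/eqP/gram_eq0; rewrite retr_mulC h retr0.
Qed.

Lemma ee_partial_ge k j : (j <= K)%N -> ee (partial 0 1) <= ee (partial k j.+1).
Proof.
move=> jK; case: k => [|k]; first exact: ee_partial_mono.
rewrite (@le_trans _ _ (ee (Q 1%N))) //.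
  by rewrite -[in leRHS](partialK 0) ee_partial_mono.
rewrite (@le_trans _ _ (ee (Q k.+1))) ?ee_mono_le //.
by rewrite -{1}(partial0 k.+1) ee_partial_mono.
Qed.

Lemma trsum_partial_bounded : exists beta, forall k j, (j <= K.+1)%N ->
  trsum (partial k j) <= beta.
Proof.
have [b hb] := ee_coercive H a0 s0 e0 c00 ee_first_gt0.
(* The starting tuple lies below the level to which coercivity applies, but its power is 0. *)
exists (Num.max 0 b) => k [_|j jK]; last first.
  by rewrite le_max (hb _ (pos_partial _ _)) ?orbT // ee_partial_ge.
case: k => [|k].
  rewrite partial0 le_max /trsum big1 ?lexx // => i _.
  by case: hQ => -> _; rewrite retr0.
rewrite partial0 -partialK le_max (hb _ (pos_partial _ _)) ?orbT //.
exact: ee_partial_ge.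
Qed.

Local Notation gain k := (ee (Q k.+1) - ee (Q k)).

Lemma gain_ge0 k : 0 <= gain k.
Proof. by rewrite subr_ge0 ee_mono. Qed.

(** While block [i] is updated, the total covariance moves only through user [i], so [step_increase]
    bounds the individual change. *)
Lemma covH_step : exists2 C, 0 <= C & forall k i,
  l1 (covH i (Q k.+1 i) - covH i (Q k i)) <= C * Num.sqrt (gain k).
Proof.
have [beta hb] := trsum_partial_bounded.
have [C C0 hC] := step_increase H a0 s0 e0 c00 beta.
exists (s^-1 * Num.sqrt C); first by rewrite mulr_ge0 ?sqrtr_ge0 // invr_ge0 ltW.
move=> k i.
have h := hC (partial k i) (partial k i.+1) i (pos_partial _ _) (pos_partial _ _)
  (hb _ _ (ltnW (ltn_ord i))) (hb _ _ (ltn_ord i)) (@partial_other k i)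
  (@block_optimal k i).
have h2 : ee (partial k i.+1) - ee (partial k i) <= gain k.
  rewrite lerB // -?(partialK k) ?ee_partial_mono //.
  by rewrite -{1}(partial0 k) ee_partial_mono // ltnW.
have covE : cov (partial k i.+1) - cov (partial k i) =
    s%:C *: (covH i (Q k.+1 i) - covH i (Q k i)).
  rewrite partialS cov_upd addrC addKr covHB.
  by have -> : partial k i i = Q k i by rewrite /partial ltnn.
rewrite -mulrA -sqrtrM // mulrC ler_pdivlMr // mulrC.
have -> : s * l1 (covH i (Q k.+1 i) - covH i (Q k i)) =
    l1 (cov (partial k i.+1) - cov (partial k i)).
  by rewrite covE l1Z gtr0_norm.
rewrite -(@ler_pXn2r _ 2) ?nnegrE ?l1_ge0 ?sqrtr_ge0 //.
rewrite sqr_sqrtr ?(mulr_ge0 C0 (gain_ge0 k)) // (le_trans h) //.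
exact: ler_wpM2l.
Qed.

Lemma cov_sweep : exists2 C, 0 <= C & forall k j,
  l1 (cov (Q k.+1) - cov (partial k j)) <= C * Num.sqrt (gain k).
Proof.
have [C C0 hC] := covH_step.
exists (s * (K.+1%:R * C)); first by rewrite mulr_ge0 ?(ltW s0) // mulr_ge0.
move=> k j; rewrite covB // l1Z (gtr0_norm s0) -mulrA ler_pM2l //.
rewrite (le_trans (l1_sum _ _ _)) //.
rewrite (@le_trans _ _ (\sum_(i < K.+1) C * Num.sqrt (gain k))) //; last first.
  by rewrite sumr_const card_ord -mulrA mulr_natl.
apply: ler_sum => i _; rewrite /partial; case: ifP => _.
  by rewrite subrr covH0 l1_0 mulr_ge0 ?sqrtr_ge0.
by rewrite covHB.
Qed.

(** For [l = ee (Q k.+1)] the surrogate is 0 at [Q k.+1] and at least [(ee Qs - l) * c0] at [Qo]. By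
    concavity the gap is thus bounded by the gradients at [Q k.+1], which would be nonpositive if
    all blocks were optimal there. *)
Lemma gap_le_gain (Qs : tuple) : pos Qs -> (forall Q, pos Q -> ee Q <= ee Qs) ->
  exists2 C, 0 <= C & forall k Qo, pos Qo -> ee Qo = ee Qs ->
    trsum Qo <= trsum Qs ->
    ee Qs - ee (Q k.+1) <=
    C * Num.sqrt (gain k) * \sum_i l1 (Qo i - Q k.+1 i).
Proof.
move=> pQs hmax; have [beta hb] := trsum_partial_bounded.
have [c c0' hc] := surrogate_concave H e c0 a0 s0 (Num.max beta (trsum Qs)).
have [C1 C10 hC1] := cov_sweep.
pose h i : R := l1 (H i) * l1 (H i).
have h0 i : 0 <= h i by rewrite mulr_ge0 ?l1_ge0.
pose hs := \sum_i h i.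
have hhs i : h i <= hs by rewrite /hs (bigD1 i) //= lerDl sumr_ge0.
have hs0 : 0 <= hs by exact: sumr_ge0.
pose ls := ee Qs.
have ls0 : 0 <= ls := ee_ge0 H a0 s0 e0 c00 pQs.
pose k1 := a * s * (M%:R ^+ 6 * C1 * hs) + Num.sqrt ls * e.
have k10 : 0 <= k1.
  rewrite addr_ge0 // mulr_ge0 ?(ltW e0) ?sqrtr_ge0 ?(ltW (mulr_gt0 a0 s0)) //.
  by rewrite mulr_ge0 // mulr_ge0 // exprn_ge0.
exists (k1 / c0); first by rewrite divr_ge0 // ltW.
move=> k Qo pQo eQo tQo; set S := \sum_i _.
pose l := ee (Q k.+1); pose r := Num.sqrt (gain k).
have r0 : 0 <= r := sqrtr_ge0 _.
have lls : l <= ls := hmax _ (pos_iterate k.+1).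
have gainE : gain k = r * r by rewrite -expr2 sqr_sqrtr // gain_ge0.
have rls : r <= Num.sqrt ls.
  have g0 : 0 <= ee (Q k) := ee_ge0 H a0 s0 e0 c00 (pos_iterate k).
  by apply: ler_wsqrtr; rewrite lerBlDr (le_trans lls) // lerDl.
have gradi i : grad H a s e (cov (Q k.+1)) i (Qo i - Q k.+1 i) l <=
    k1 * r * l1 (Qo i - Q k.+1 i).
  (* Block [i] is optimal at [T]. Between [T] and the end of the sweep both the covariance and the
     value change, which yields the two summands of [k1]. *)
  set V := _ - _; pose T := partial k i.+1.
  have fo : grad H a s e (cov T) i V (ee T) <= 0.
    rewrite /V -(partialS_same k i).
    exact: (first_order a0 s0 e0 c00 (pos_partial k i.+1) (@block_optimal k i) (pQo i)).
  have pT := psdmx_cov H s0 (pos_partial k i.+1).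
  have pQk := psdmx_cov H s0 (pos_iterate k.+1).
  have h1 : retr (invmx (cov (Q k.+1)) *m covH i V) -
      retr (invmx (cov T) *m covH i V) <= M%:R ^+ 6 * C1 * hs * r * l1 V.
    rewrite -retrB -mulmxBl (le_trans (ler_norm _)) // (le_trans (retr_le _)) //.
    rewrite (le_trans (l1M _ _)) //.
    have b1 : l1 (invmx (cov (Q k.+1)) - invmx (cov T)) <= M%:R ^+ 6 * (C1 * r).
      by rewrite (le_trans (l1_invB pQk pT)) // ler_wpM2l ?exprn_ge0 // hC1.
    have b2 : l1 (covH i V) <= hs * l1 V.
      rewrite covH.unlock (le_trans (l1M _ _)) //.
      rewrite (@le_trans _ _ (l1 (H i) * l1 V * l1 (H i))) //.
        by rewrite ler_wpM2r ?l1_ge0 // (le_trans (l1M _ _)) // l1_adj.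
      by rewrite [leLHS]mulrAC ler_wpM2r ?l1_ge0 //; exact: hhs.
    rewrite (le_trans (ler_pM (l1_ge0 _) (l1_ge0 _) b1 b2)) //.
    by rewrite le_eqVlt; apply/orP; left; apply/eqP; ring.
  have h2 : ee T * e * retr V - l * e * retr V <= Num.sqrt ls * e * r * l1 V.
    have Tl : ee T <= l by rewrite /l -(partialK k) ee_partial_mono.
    (* The gain is [r * r]; bounding one factor by [Num.sqrt ls] makes this error linear in [r],
       like that of the covariance. *)
    have lT : l - ee T <= Num.sqrt ls * r.
      rewrite (@le_trans _ _ (gain k)) ?lerB //.
        by rewrite -{1}(partial0 k) ee_partial_mono.
      by rewrite gainE ler_wpM2r.
    have -> : ee T * e * retr V - l * e * retr V = (l - ee T) * e * - retr V by ring.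
    have -> : Num.sqrt ls * e * r * l1 V = (Num.sqrt ls * r) * e * l1 V by ring.
    have V1 : - retr V <= l1 V.
      by rewrite -retrN (le_trans (ler_norm _)) // (le_trans (retr_le _)) // l1N.
    rewrite (@le_trans _ _ ((l - ee T) * e * l1 V)) //.
      by rewrite ler_wpM2l // mulr_ge0 ?(ltW e0) // subr_ge0.
    by rewrite ler_wpM2r ?l1_ge0 // ler_pM2r.
  move: fo h1 h2; rewrite /grad /k1.
  move: (retr (_ *m _)) (retr (_ *m _)) (retr V) (l1 V) (ee T).
  move=> x y z w t fo h1 h2.
  have := ler_wpM2l (ltW (mulr_gt0 a0 s0)) h1; lra.
have := hc (Q k.+1) Qo l (pos_iterate _) pQo.
rewrite (ee_pow H a s e0 c00 pQo) (ee_pow H a s e0 c00 (pos_iterate k.+1)) subrr add0r.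
rewrite !le_max tQo orbT -(partialK k) hb //= (partialK k) => /(_ isT isT) hsur.
have hP : c0 <= pow Qo by rewrite lerDr; exact: mulr_ge0 (ltW e0) (trsum_ge0 pQo).
have hs1 : \sum_i grad H a s e (cov (Q k.+1)) i (Qo i - Q k.+1 i) l <= k1 * r * S.
  by rewrite /S mulr_sumr; apply: ler_sum => i _.
have sq0 : 0 <= c * l1 (cov Qo - cov (Q k.+1)) ^+ 2.
  by rewrite mulr_ge0 ?(ltW c0') // sqr_ge0.
have kE (x y z t : R) : x / y * z * t = x * z * t / y by ring.
rewrite kE ler_pdivlMr // -/l -/ls -/r.
have d0 : 0 <= ls - l by rewrite subr_ge0.
have := ler_wpM2l d0 hP; rewrite eQo -/ls in hsur.
move: hsur hs1 sq0; move: (\sum_i grad _ _ _ _ _ _ _ _) (l1 _ ^+ 2) (pow Qo).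
move=> x y z; lra.
Qed.

Lemma covH_cauchy i : mxcauchy (fun k => covH i (Q k i)).
Proof.
have [Qs pQs hmax] := exists_maximizer a0 s0 e0 c00 (pos_partial 0 1) ee_first_gt0.
have [beta hb] := trsum_partial_bounded.
have ls0 : 0 < ee Qs := lt_le_trans ee_first_gt0 (hmax _ (pos_partial _ _)).
have tQs : trsum Qs <= Num.max beta (trsum Qs) by rewrite le_max lexx orbT.
have [m [C1 C10 hC1]] := hoelder_error_bound a0 s0 e0 c00 pQs tQs ls0 hmax.
have [C2 C20 hC2] := gap_le_gain pQs hmax.
have [C3 C30 hC3] := covH_step.
pose delta k := ee Qs - ee (Q k).
have d0 k : 0 <= delta k by rewrite subr_ge0; exact: hmax (pos_iterate k).
pose v k := delta k `^ (m.+2%:R^-1).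
have v0 k : 0 <= v k by exact: powR_ge0.
have vE k : v k ^+ m.+2 = delta k.
  by rewrite -powR_mulrn // -powRrM mulVf ?pnatr_eq0 // powRr1.
have vS k : v k.+1 <= v k.
  rewrite -(@ler_pXn2r _ m.+2) ?nnegrE // !vE lerB // ee_mono //.
have gainE k : gain k = v k ^+ m.+2 - v k.+1 ^+ m.+2.
  by rewrite !vE /delta; ring.
have kl k : v k.+1 ^+ m.+1 <=
    C2 * (1 + C1) * Num.sqrt (v k ^+ m.+2 - v k.+1 ^+ m.+2).
  rewrite -gainE; have [v00|vN0] := eqVneq (v k.+1) 0.
    by rewrite v00 expr0n mulr_ge0 ?sqrtr_ge0 // mulr_ge0 // addr_ge0.
  have vp : 0 < v k.+1 by rewrite lt_neqAle eq_sym vN0 v0.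
  have tk : trsum (Q k.+1) <= Num.max beta (trsum Qs).
    by rewrite le_max -(partialK k) hb.
  have [Qo [pQo eQo tQo hQo]] := hC1 _ (pos_iterate k.+1) tk.
  set S := \sum_i _ in hQo.
  have S0 : 0 <= S by apply: sumr_ge0 => j _; exact: l1_ge0.
  (* [1 + C1] replaces the root of order [m.+2] of [C1], which it exceeds. *)
  have hS : S <= (1 + C1) * v k.+1.
    rewrite -(@ler_pXn2r _ m.+2) ?nnegrE ?mulr_ge0 ?addr_ge0 //.
    rewrite (le_trans hQo) // exprMn vE ler_wpM2r ?(d0 k.+1) // exprS.
    by rewrite (@le_trans _ _ (1 + C1)) ?lerDr // ler_peMr ?addr_ge0 // exprn_ege1 // lerDl.
  have := hC2 k Qo pQo eQo; rewrite tQo lexx => /(_ isT).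
  rewrite -/S -/(delta k.+1) -vE exprS => h.
  (* The bound on the distance contributes one factor [v k.+1], which cancels; hence the exponent
     [m.+1]. *)
  rewrite -(ler_pM2l vp) (le_trans h) //.
  rewrite (@le_trans _ _ (C2 * Num.sqrt (gain k) * ((1 + C1) * v k.+1))) //.
    by rewrite ler_wpM2l // mulr_ge0 ?sqrtr_ge0.
  by rewrite le_eqVlt; apply/orP; left; apply/eqP; ring.
have CC0 : 0 <= C2 * (1 + C1) by rewrite mulr_ge0 // addr_ge0.
have [C4 C40 hC4] := sqrt_step_telescopes CC0 v0 vS kl.
apply: (@mxcauchy_telescope _ _ _ _ v (C3 * C4)) => // [|k].
  by rewrite mulr_ge0.
by rewrite (le_trans (hC3 k i)) // -mulrA ler_wpM2l // gainE.
Qed.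

Lemma iterate_cauchy i : mxcauchy (fun k => Q k i).
Proof.
(* [Q 0] does not come from an update, so the stationarity equation is available from index 1 on. *)
apply: mxcauchy_shift.
have [Qs pQs hmax] := exists_maximizer a0 s0 e0 c00 (pos_partial 0 1) ee_first_gt0.
(* Block [i] is stationary at the tuple right after its update, so values and covariances are
   followed along these intermediate tuples. *)
pose l k := ee (partial k i.+1).
have lge k : ee (partial 0 1) <= l k by apply: ee_partial_ge; rewrite -ltnS.
have l0 k : 0 < l k := lt_le_trans ee_first_gt0 (lge k).
have hl : rcauchy l.
  apply: (@nondecreasing_rcauchy _ _ (ee Qs)) => k; last first.
    exact: hmax (pos_partial _ _).
  rewrite (@le_trans _ _ (ee (Q k.+1))) //.
    by rewrite -(partialK k) ee_partial_mono.
  by rewrite -{1}(partial0 k.+1) ee_partial_mono.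
pose X k := cov (partial k i.+1).
have hX : mxcauchy X.
  rewrite /X cov.unlock; apply: mxcauchyD; first exact: mxcauchyC.
  have -> : (fun k => s%:C *: \sum_j covH j (partial k i.+1 j)) =
      (fun k => s%:C *: 1%:M *m \sum_j covH j (partial k i.+1 j)).
    by apply/funext => k; rewrite -scalemxAl mul1mx.
  apply: mxcauchyM; first exact: mxcauchyC.
  apply: mxcauchy_sum => j; rewrite /partial.
  by case: (j < i.+1)%N; [exact: mxcauchyS (covH_cauchy j) | exact: covH_cauchy].
have pX k : psdmx (X k - 1%:M) := psdmx_cov H s0 (pos_partial k i.+1).
pose G k := (a * s / e * (l k)^-1)%:C *: (H i *m invmx (X k)).
have hG : mxcauchy G.
  apply: mxcauchyZ; first exact/rcauchyZ/(rcauchyV ee_first_gt0 lge).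
  by apply: mxcauchyM; [exact: mxcauchyC | exact: mxcauchyV].
have -> : (fun k => Q k.+1 i) =
    (fun k => G k *m covH i (Q k.+1 i) *m (G k)^t*).
  apply/funext => k; rewrite -(partialS_same k i).
  apply: (stationary_block a0 s0 e0 c00); [exact: pos_partial | exact: l0 |].
  exact: block_optimal.
apply: mxcauchyM; first exact: mxcauchyM hG (mxcauchyS (covH_cauchy i)).
move=> eps /hG [n hn]; exists n => p q np nq.
by rewrite -adjB l1_adj hn.
Qed.

Lemma ee_cvg : exists l : R, (ee (Q k) @[k --> \oo] --> l)%classic.
Proof.
have [Qs pQs hmax] := exists_maximizer a0 s0 e0 c00 (pos_partial 0 1) ee_first_gt0.
have : cvgn (fun k => ee (Q k)).
  apply: nondecreasing_is_cvgn => [k l kl|]; first exact: ee_mono_le.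
  by exists (ee Qs) => _ [k _ <-]; apply: hmax; exact: pos_iterate.
by move=> /cvg_ex.
Qed.
End Waterfilling.

(* The theorem in the original parameters *)
Local Close Scope sesquilinear_scope.
Local Open Scope classical_set_scope.
Local Open Scope ring_scope.
Local Open Scope complex_scope.

Theorem mainTheorem2 (R : realType) (M N K : nat)
  (hM : (1 <= M)%N) (hN : (1 <= N)%N) (hK : (1 <= K)%N)
  (H : 'I_K -> 'M[R[i]]_(N, M)) (hH : forall i, H i != 0)
  (W sigma2 eta Pdyn Psta : R)
  (hW : 0 < W) (hsigma2 : 0 < sigma2) (heta : 0 < eta)
  (hPdyn : 0 < Pdyn) (hPsta : 0 < Psta)
  (Q : nat -> 'I_K -> 'M[R[i]]_N)
  (hQ : iterative_waterfilling
          (energy_efficiency H W sigma2 eta Pdyn Psta) Q) :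
  (exists l : R,
     energy_efficiency H W sigma2 eta Pdyn Psta (Q k) @[k --> \oo] --> l) /\
  (* R[i]^o is R[i] with the topology of its modulus. *)
  (exists L : 'I_K -> 'M[R[i]^o]_N,
     forall i : 'I_K, (Q k i : 'M[R[i]^o]_N) @[k --> \oo] --> L i).
Proof.
case: K hK H hH Q hQ => [//|K] _ H hH Q hQ.
have a0 : 0 < W / ln 2 by rewrite divr_gt0 // ln_gt0 // ltr1n.
have s0 : 0 < sigma2^-1 by rewrite invr_gt0.
have e0 : 0 < eta^-1 by rewrite invr_gt0.
have c00 : 0 < M%:R * Pdyn + Psta by rewrite ltr_wpDl // mulr_ge0 // ltW.
have eeE : energy_efficiency H W sigma2 eta Pdyn Psta =
    ee H (W / ln 2) sigma2^-1 eta^-1 (M%:R * Pdyn + Psta).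
  apply/funext => q; rewrite /energy_efficiency /ee /pow /trsum.
  rewrite ld.unlock cov.unlock covH.unlock retr.unlock /log2 addrA.
  by rewrite [W * (_ / _)]mulrA [W / _ * _]mulrAC.
rewrite eeE in hQ *; split; first exact: (ee_cvg a0 s0 e0 c00 hH hQ).
have h i := mxcauchy_cvg (iterate_cauchy a0 s0 e0 c00 hH hQ i).
by exists (fun i => sval (cid (h i))) => i; exact: svalP (cid (h i)).
Qed.
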